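(* Let $\mathbb{F}\in\{\mathbb{R},\mathbb{C}\}$, let $n=p+q\ge 1$, and let $V$ be a Euclidean space of dimension $r\ge 1$ with Cartesian coordinates $x^1,\dots,x^r$ and $\partial_\mu=\partial/\partial x^\mu$. Let $h^a:V\to\mathcal{C}\ell^{\mathbb{F}}(p,q)$, $a=1,\dots,n$, be smooth functions satisfying $$h^a(x)h^b(x)+h^b(x)h^a(x)=2\eta^{ab}e,\qquad a,b=1,\dots,n,\quad \forall x\in V,$$ and, in the case of odd $n$, additionally $\mathrm{Tr}(h^{1\ldots n})=0$, where $h^{1\ldots n}:=h^1(x)\cdots h^n(x)$. Let $C_\mu:V\to\mathcal{N}$, $\mu=1,\dots,r$, be the unique $\mathcal{N}$-valued solution of the system $$\partial_\mu h^a-[C_\mu,h^a]=0,\qquad a=1,\dots,n,\quad \mu=1,\dots,r,$$ where $\mathcal{N}$ is the complement of the center of $\mathcal{C}\ell^{\mathbb{F}}(p,q)$ defined in the context. Then there exists a function $S=S(x):V\to\mathcal{C}\ell^{\mathbb{F}}(p,q)$, invertible for every $x\in V$, satisfying $$\partial_\mu S(x)=C_\mu(x)S(x),\qquad \mu=1,\dots,r,\quad \forall x\in V,\qquad ( * )$$ and there exists a function of the form $T(x)=S(x)K$, with $K\in\mathcal{C}\ell^{\mathbb{F}}(p,q)$ an invertible element not depending on $x$, which is also a solution of $( * )$, is invertible for every $x\in V$, and connects the two sets of elements: $$e^a=T^{-1}(x)h^a(x)T(x),\qquad a=1,\dots,n,\quad\forall x\in V,$$ in the case of even $n$, and $$e^a=h^{1\ldots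 n}e_{1\ldots n}\,T^{-1}(x)h^a(x)T(x),\qquad a=1,\dots,n,\quad\forall x\in V,$$ in the case of odd $n$, where $h^{1\ldots n}e_{1\ldots n}=\pm e$.
   Context: $\mathcal{C}\ell^{\mathbb{R}}(p,q)$, $n=p+q$, is the real Clifford algebra with identity $e$ and generators $e^1,\dots,e^n$ (independent of $x$) satisfying $e^ae^b+e^be^a=2\eta^{ab}e$, where $\eta=\|\eta^{ab}\|$ is the diagonal matrix with $p$ entries $1$ followed by $q$ entries $-1$. It has dimension $2^n$, with basis $e^{a_1\ldots a_k}:=e^{a_1}\cdots e^{a_k}$, $a_1<\dots<a_k$, $0\le k\le n$ (the empty product being $e$). $\mathcal{C}\ell^{\mathbb{C}}(p,q)=\mathbb{C}\otimes\mathcal{C}\ell^{\mathbb{R}}(p,q)$. $\mathcal{C}\ell^{\mathbb{F}}_k(p,q)$ is the $\mathbb{F}$-span of the basis elements with multi-index of length $k$. $\mathrm{Tr}:\mathcal{C}\ell^{\mathbb{F}}(p,q)\to\mathcal{C}\ell^{\mathbb{F}}_0(p,q)$ is the projection onto the grade-$0$ subspace along the other grades. $e_{1\ldots n}:=(e^{1\ldots n})^{-1}$ with $e^{1\ldots n}=e^1\cdots e^n$. $[U,W]=UW-WU$. The center of $\mathcal{C}\ell^{\mathbb{F}}(p,q)$ is $\mathcal{C}\ell^{\mathbb{F}}_0(p,q)$ for even $n$ and $\mathcal{C}\ell^{\mathbb{F}}_0(p,q)\oplus\mathcal{C}\ell^{\mathbb{F}}_n(p,q)$ for odd $n$; $\mathcal{N}:=\bigoplus_{k=1}^{2\lfloor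 n/2\rfloor}\mathcal{C}\ell^{\mathbb{F}}_k(p,q)$ is its complement consisting of elements with no central component. It is known (from earlier work) that under the stated hypotheses the system for $C_\mu$ has a unique $\mathcal{N}$-valued solution, given by $C_\mu=\sum_{k=1}^{2\lfloor n/2\rfloor}\mu_k\,\pi[h]_k\big(\sum_{a=1}^n(\partial_\mu h^a)h_a\big)$, where $\mu_k=\frac{1}{n-(-1)^k(n-2k)}$, $h_a=(h^a)^{-1}$, and $\pi[h]_k$ is the projection onto the span of the products $h^{a_1}\cdots h^{a_k}$, $a_1<\dots<a_k$, with respect to the basis of all such ordered products. Functions into the algebra are smooth if their coordinates in the fixed basis are smooth. *)

(* Defs.v *)
From HB Require Import structures.
From mathcomp Require Import all_boot all_order all_algebra all_field.
From mathcomp Require Import complex.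
From mathcomp Require Import all_classical all_reals all_analysis.

Set Implicit Arguments.
Unset Strict Implicit.
Unset Printing Implicit Defensive.

Import Order.TTheory GRing.Theory Num.Theory.
Import numFieldNormedType.Exports.

Local Open Scope ring_scope.

(** The Clifford algebra Cl^F(p, q). An element is the family of its
    coordinates U_A in the basis e^A := e^(a_1) ... e^(a_k), where
    A = {a_1 < ... < a_k} is a set of indices (the indices are numbered from 0,
    those smaller than p square to 1, the others to -1). *)

Definition cliff (F : fieldType) (p q : nat) := {ffun {set 'I_(p + q)} -> F^o}.

HB.instance Definition _ (F : fieldType) (p q : nat) := GRing.Lmodule.on (cliff F p q).
HB.instance Definition _ (F : fieldType) (p q : nat) := Vector.on (cliff F p q).

Definition coord_cl (F : fieldType) p q (U : cliff F p q) (A : {set 'I_(p + q)})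
  : F := U A.

Definition basis_cl (F : fieldType) p q (A : {set 'I_(p + q)}) : cliff F p q :=
  [ffun B => (B == A)%:R].

(** The matrix eta^{ab}. *)
Definition eta (F : fieldType) (p q : nat) : 'M[F]_(p + q) :=
  diag_mx (\row_a (if (a < p)%N then 1 else -1)).

Definition symdiff (T : finType) (A B : {set T}) : {set T} :=
  (A :\: B) :|: (B :\: A).

(** In e^A e^B one moves each generator e^b of e^B to its place among the
    generators of e^A: passing e^a with b < a gives a factor -1, and meeting
    e^a with a = b gives the factor eta^{aa}. Hence
    e^A e^B = sgn_cl A B *: e^(symdiff A B). *)
Definition sgn1_cl (F : fieldType) p q (a b : 'I_(p + q)) : F :=
  if (b < a)%N then -1 else if a == b then eta F p q a a else 1.

Definition sgn_cl (F : fieldType) p q (A B : {set 'I_(p + q)}) : F :=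
  \prod_(a in A) \prod_(b in B) sgn1_cl F a b.

Definition mul_cl (F : fieldType) p q (U W : cliff F p q) : cliff F p q :=
  \sum_A \sum_B
    (coord_cl U A * coord_cl W B * sgn_cl F A B) *: basis_cl F (symdiff A B).

Section Ring.
Variables (F : fieldType) (p q : nat).
Implicit Types (A B D : {set 'I_(p + q)}) (U W Z : cliff F p q).

Lemma symdiffE (T : finType) (A B : {set T}) x :
  (x \in symdiff A B) = (x \in A) (+) (x \in B).
Proof. by rewrite !inE; case: (x \in A); case: (x \in B). Qed.

Lemma symdiffA (T : finType) : associative (@symdiff T).
Proof. by move=> A B D; apply/setP=> x; rewrite !symdiffE addbA. Qed.

Lemma symdiff0A (T : finType) : left_id finset.set0 (@symdiff T).
Proof. by move=> A; apply/setP=> x; rewrite symdiffE inE. Qed.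

Lemma symdiffA0 (T : finType) : right_id finset.set0 (@symdiff T).
Proof. by move=> A; apply/setP=> x; rewrite symdiffE inE addbF. Qed.

Lemma etaE (a b : 'I_(p + q)) :
  eta F p q a b = if a == b then (if (a < p)%N then 1 else -1) else 0.
Proof. by rewrite /eta !mxE; case: eqP => [->|]. Qed.

Lemma sgn1_cl_sqr (a b : 'I_(p + q)) : sgn1_cl F a b * sgn1_cl F a b = 1.
Proof.
rewrite /sgn1_cl etaE eqxx.
by do ![case: ifP => _]; rewrite ?mulrNN ?mulr1.
Qed.

Lemma prod_symdiff (T : finType) (f : T -> F) (A B : {set T}) :
  (forall a, f a * f a = 1) ->
  \prod_(a in symdiff A B) f a = (\prod_(a in A) f a) * \prod_(a in B) f a.
Proof.
move=> f2; rewrite !(big_mkcond (fun a => a \in _)) -big_split /=.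
apply: eq_bigr => a _; rewrite symdiffE.
by case: (a \in A); case: (a \in B); rewrite /= ?mulr1 ?mul1r ?f2.
Qed.

Lemma sgn_clDl A B D :
  sgn_cl F (symdiff A B) D = sgn_cl F A D * sgn_cl F B D.
Proof.
rewrite /sgn_cl prod_symdiff // => a; rewrite -big_split /=.
by rewrite big1 // => b _; apply: sgn1_cl_sqr.
Qed.

Lemma sgn_clDr A B D :
  sgn_cl F A (symdiff B D) = sgn_cl F A B * sgn_cl F A D.
Proof.
rewrite /sgn_cl -big_split /=; apply: eq_bigr => a _.
by rewrite prod_symdiff // => b; apply: sgn1_cl_sqr.
Qed.

Lemma coord_basis_cl A B : coord_cl (basis_cl F A) B = (B == A)%:R.
Proof. by rewrite /coord_cl ffunE. Qed.

Lemma cliffP U W : (forall A, coord_cl U A = coord_cl W A) -> U = W.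
Proof. by move=> UW; apply/ffunP. Qed.

Lemma coord_clD U W A : coord_cl (U + W) A = coord_cl U A + coord_cl W A.
Proof. by rewrite /coord_cl ffunE. Qed.

Lemma coord_clZ c U A : coord_cl (c *: U) A = c * coord_cl U A.
Proof. by rewrite /coord_cl ffunE. Qed.

Lemma coord_cl_sum (I : Type) (s : seq I) (P : pred I) (f : I -> cliff F p q) A :
  coord_cl (\sum_(i <- s | P i) f i) A =
  \sum_(i <- s | P i) coord_cl (f i) A.
Proof. by rewrite /coord_cl sum_ffunE. Qed.

Lemma cliffE U : U = \sum_A coord_cl U A *: basis_cl F A.
Proof.
apply: cliffP => A; rewrite coord_cl_sum (bigD1 A) //= big1 => [|B BA].
  by rewrite coord_clZ coord_basis_cl eqxx mulr1 addr0.
by rewrite coord_clZ coord_basis_cl eq_sym (negPf BA) mulr0.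
Qed.

Lemma mul_clDl : left_distributive (@mul_cl F p q) +%R.
Proof.
move=> U W Z; rewrite -big_split; apply: eq_bigr => A _.
rewrite -big_split; apply: eq_bigr => B _ /=.
by rewrite coord_clD !mulrDl scalerDl.
Qed.

Lemma mul_clDr : right_distributive (@mul_cl F p q) +%R.
Proof.
move=> U W Z; rewrite -big_split; apply: eq_bigr => A _.
rewrite -big_split; apply: eq_bigr => B _ /=.
by rewrite coord_clD mulrDr mulrDl scalerDl.
Qed.

Lemma mul_clZl c U W : mul_cl (c *: U) W = c *: mul_cl U W.
Proof.
rewrite /mul_cl scaler_sumr; apply: eq_bigr => A _.
rewrite scaler_sumr; apply: eq_bigr => B _.
by rewrite scalerA coord_clZ !mulrA.
Qed.

Lemma mul_clZr c U W : mul_cl U (c *: W) = c *: mul_cl U W.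
Proof.
rewrite /mul_cl scaler_sumr; apply: eq_bigr => A _.
rewrite scaler_sumr; apply: eq_bigr => B _.
by rewrite scalerA coord_clZ !mulrA (mulrC c).
Qed.

Lemma mul_basis_cl A B :
  mul_cl (basis_cl F A) (basis_cl F B) =
  sgn_cl F A B *: basis_cl F (symdiff A B).
Proof.
rewrite /mul_cl (bigD1 A) //= [X in _ + X]big1 => [|A' nA]; last first.
  by rewrite big1 // => B' _; rewrite coord_basis_cl (negPf nA) !mul0r scale0r.
rewrite addr0 (bigD1 B) //= [X in _ + X]big1 => [|B' nB]; last first.
  by rewrite (coord_basis_cl B) (negPf nB) mulr0 mul0r scale0r.
by rewrite !coord_basis_cl !eqxx !mul1r addr0.
Qed.

Lemma mul_clPl c U W Z : mul_cl (c *: U + W) Z = c *: mul_cl U Z + mul_cl W Z.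
Proof. by rewrite mul_clDl mul_clZl. Qed.

Lemma mul_clPr c U W Z : mul_cl Z (c *: U + W) = c *: mul_cl Z U + mul_cl Z W.
Proof. by rewrite mul_clDr mul_clZr. Qed.

Lemma basis_cl_ext (f g : cliff F p q -> cliff F p q) :
  linear f -> linear g ->
  (forall A, f (basis_cl F A) = g (basis_cl F A)) -> f =1 g.
Proof.
move=> lf lg fg U; rewrite (cliffE U).
pose f' : {linear _ -> _} := HB.pack f (GRing.isLinear.Build _ _ _ _ f lf).
pose g' : {linear _ -> _} := HB.pack g (GRing.isLinear.Build _ _ _ _ g lg).
rewrite -[f]/(f' : _ -> _) -[g]/(g' : _ -> _) !linear_sum.
by apply: eq_bigr => A _; rewrite !linearZ /= fg.
Qed.

Lemma mul_clA : associative (@mul_cl F p q).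
Proof.
move=> U W Z; move: U; apply: basis_cl_ext => [c U U'|c U U'|A].
- exact: mul_clPl.
- by rewrite 2!mul_clPl.
move: W; apply: basis_cl_ext => [c W W'|c W W'|B].
- by rewrite mul_clPl mul_clPr.
- by rewrite mul_clPr mul_clPl.
move: Z; apply: basis_cl_ext => [c Z Z'|c Z Z'|D].
- by rewrite 2!mul_clPr.
- exact: mul_clPr.
rewrite 2!mul_basis_cl mul_clZl mul_clZr 2!mul_basis_cl 2!scalerA symdiffA.
by rewrite sgn_clDl sgn_clDr mulrC -mulrA.
Qed.

Lemma mul_1cl : left_id (basis_cl F finset.set0) (@mul_cl F p q).
Proof.
apply: basis_cl_ext => [c U W|//|A]; first exact: mul_clPr.
by rewrite mul_basis_cl symdiff0A /sgn_cl big_set0 scale1r.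
Qed.

Lemma mul_cl1 : right_id (basis_cl F finset.set0) (@mul_cl F p q).
Proof.
apply: (@basis_cl_ext (fun U => mul_cl U _)) => [c U W|//|A].
  exact: mul_clPl.
rewrite mul_basis_cl symdiffA0 /sgn_cl big1 ?scale1r // => a _.
by rewrite big_set0.
Qed.

Lemma basis_cl_neq0 A : basis_cl F A != 0.
Proof.
apply/eqP => /(congr1 (fun U : cliff F p q => coord_cl U A)).
by rewrite coord_basis_cl eqxx /coord_cl ffunE => /eqP; rewrite oner_eq0.
Qed.

End Ring.

HB.instance Definition _ (F : fieldType) (p q : nat) :=
  GRing.Zmodule_isNzRing.Build (cliff F p q) (@mul_clA F p q) (@mul_1cl F p q)
    (@mul_cl1 F p q) (@mul_clDl F p q) (@mul_clDr F p q)
    (@basis_cl_neq0 F p q finset.set0).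

Fact scale_clAl (F : fieldType) p q (c : F)
  (U W : cliff F p q) : c *: (U * W) = (c *: U) * W.
Proof. by rewrite [RHS]mul_clZl. Qed.
Fact scale_clAr (F : fieldType) p q (c : F)
  (U W : cliff F p q) : c *: (U * W) = U * (c *: W).
Proof. by rewrite [RHS]mul_clZr. Qed.

HB.instance Definition _ (F : fieldType) (p q : nat) :=
  GRing.Lmodule_isLalgebra.Build F (cliff F p q) (@scale_clAl F p q).
HB.instance Definition _ (F : fieldType) (p q : nat) :=
  GRing.Lalgebra_isAlgebra.Build F (cliff F p q) (@scale_clAr F p q).
(** This provides the library's units and inverse. *)
HB.instance Definition _ (F : fieldType) (p q : nat) :=
  Algebra_isFalgebra.Build F (cliff F p q).

Definition gen_cl (F : fieldType) p q (a : 'I_(p + q)) : cliff F p q :=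
  basis_cl F [set a]%SET.

(** The product h^{1...n} := h^1 ... h^n, with the factors in this order. *)
Definition full_prod (F : fieldType) p q (h : 'I_(p + q) -> cliff F p q) :
  cliff F p q := \prod_(a < p + q) h a.

Definition comm_cl (F : fieldType) p q (U W : cliff F p q) := U * W - W * U.

Definition grade_proj (F : fieldType) p q (k : nat) (U : cliff F p q) :=
  \sum_(A : {set 'I_(p + q)} | #|A| == k) coord_cl U A *: basis_cl F A.

Definition Tr_cl (F : fieldType) p q (U : cliff F p q) := grade_proj 0 U.

Definition grade_sp (F : fieldType) p q (k : nat) : {vspace cliff F p q} :=
  <<[seq basis_cl F A | A : {set 'I_(p + q)} <- enum {set 'I_(p + q)}
                      & #|A| == k]>>%VS.

(** The complement of the center: all grades from 1 to 2 * floor (n / 2). *)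
Definition noncentral_sp (F : fieldType) p q : {vspace cliff F p q} :=
  (\sum_(1 <= k < (2 * (p + q)./2).+1) grade_sp F p q k)%VS.

Section CliffordFacts.
Variables (F : fieldType) (p q : nat).

Lemma gen_cl_mul (a b : 'I_(p + q)) :
  gen_cl F a * gen_cl F b + gen_cl F b * gen_cl F a =
  (2 * eta F p q a b) *: 1.
Proof.
rewrite /gen_cl [_ * _]mul_basis_cl [X in _ + X]mul_basis_cl.
rewrite /sgn_cl !big_set1 /sgn1_cl.
have [->|nab] := eqVneq a b.
  rewrite ltnn -scalerDl mulrDl !mul1r.
  congr (_ *: basis_cl F _).
  by apply/setP=> x; rewrite symdiffE addbb inE.
have -> : symdiff [set b]%SET [set a]%SET = symdiff [set a]%SET [set b]%SET.
  by apply/setP=> x; rewrite !symdiffE addbC.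
rewrite etaE (negPf nab) mulr0 scale0r -scalerDl.
by case: (ltngtP a b) => [||/val_inj/eqP]; rewrite ?addNr ?subrr ?scale0r // (negPf nab).
Qed.

Let prod_gen_sorted (l : seq 'I_(p + q)) :
  sorted (fun a b : 'I_(p + q) => (a < b)%N) l ->
  \prod_(a <- l) gen_cl F a = basis_cl F [set a in l]%SET.
Proof.
elim: l => [|a l IHl] sl.
  by rewrite big_nil; congr basis_cl; apply/setP=> x; rewrite !inE.
have ltr : transitive (fun a b : 'I_(p + q) => (a < b)%N).
  by move=> x y z; apply: ltn_trans.
have /allP al : all (fun b : 'I_(p + q) => (a < b)%N) l.
  exact: (order_path_min ltr sl).
rewrite big_cons IHl ?(path_sorted sl) // [LHS]mul_basis_cl.
rewrite /sgn_cl big_set1 big1 ?scale1r => [|b]; last first.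
  rewrite inE => /al ab; rewrite /sgn1_cl ltnNge (ltnW ab) /=.
  by case: eqP ab => // ->; rewrite ltnn.
congr basis_cl; apply/setP=> x; rewrite symdiffE !inE.
by case: (eqVneq x a) => [->|//]; case: (boolP (a \in l)) => // /al; rewrite ltnn.
Qed.

Lemma basis_cl_prod (A : {set 'I_(p + q)}) :
  basis_cl F A = \prod_(a < p + q | a \in A) gen_cl F a.
Proof.
rewrite -big_filter prod_gen_sorted.
  congr basis_cl; apply/setP=> x.
  by rewrite inE mem_filter mem_index_enum andbT.
have ltr : transitive (fun a b : 'I_(p + q) => (a < b)%N).
  by move=> x y z; apply: ltn_trans.
apply: sorted_filter => //.
have := iota_ltn_sorted 0 (p + q).
by rewrite -val_enum_ord sorted_map enumT /index_enum; case: index_enum_key.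
Qed.

Lemma full_prod_gen : full_prod (@gen_cl F p q) = basis_cl F [set: _]%SET.
Proof. by rewrite basis_cl_prod; apply: eq_bigl => a; rewrite inE. Qed.

Let coord_fun0 (A : {set 'I_(p + q)}) (U : cliff F p q) : F^o := coord_cl U A.

Let coord_fun_linear A : linear (coord_fun0 A).
Proof. by move=> c U W; rewrite /coord_fun0 coord_clD coord_clZ. Qed.

Let coord_fun A : {linear cliff F p q -> F^o} :=
  HB.pack (coord_fun0 A)
    (GRing.isLinear.Build F (cliff F p q) F^o _ _ (coord_fun_linear A)).

Let mem_ker_coord A U : (U \in lker (linfun (coord_fun A))) = (coord_cl U A == 0).
Proof. by rewrite memv_ker lfunE. Qed.

Let basis_cl_grade (A : {set 'I_(p + q)}) : basis_cl F A \in grade_sp F p q #|A|.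
Proof.
apply/memv_span/mapP; exists A => //.
by rewrite mem_filter eqxx mem_enum.
Qed.

Let grade_sp_ker k (A : {set 'I_(p + q)}) :
  k != #|A| -> (grade_sp F p q k <= lker (linfun (coord_fun A)))%VS.
Proof.
move=> kA; apply/span_subvP => _ /mapP[B + ->].
rewrite mem_filter mem_ker_coord coord_basis_cl => /andP[/eqP Bk _].
by case: (eqVneq A B) kA => [->|//]; rewrite Bk eqxx.
Qed.

Lemma mem_grade_sp k (U : cliff F p q) :
  U \in grade_sp F p q k <->
  (forall A : {set 'I_(p + q)}, #|A| != k -> coord_cl U A = 0).
Proof.
split=> [Uk A|U0].
  rewrite eq_sym => /grade_sp_ker/subvP/(_ _ Uk).
  by rewrite mem_ker_coord => /eqP.
rewrite (cliffE U); apply: memv_suml => A _.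
have [/eqP <-|/U0 ->] := boolP (#|A| == k); last by rewrite scale0r mem0v.
exact/memvZ/basis_cl_grade.
Qed.

Lemma mem_noncentral_sp (U : cliff F p q) :
  U \in noncentral_sp F p q <->
  (forall A : {set 'I_(p + q)},
     ~~ (1 <= #|A| <= 2 * (p + q)./2)%N -> coord_cl U A = 0).
Proof.
split=> [UN A nA|U0].
  apply/eqP; rewrite -mem_ker_coord; apply: subvP UN.
  rewrite /noncentral_sp big_seq_cond.
  apply: (big_ind (fun V => V <= lker (linfun (coord_fun A)))%VS)
    => [|V W VA WA|k].
  - exact: sub0v.
  - by rewrite subv_add VA.
  rewrite andbT mem_index_iota ltnS => kN.
  by apply: grade_sp_ker; apply: contra nA => /eqP <-.
rewrite (cliffE U); apply: memv_suml => A _.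
have [AN|/U0 ->] := boolP (1 <= #|A| <= 2 * (p + q)./2)%N; last first.
  by rewrite scale0r mem0v.
apply: memvZ; move: (basis_cl_grade A); apply: subvP.
rewrite /noncentral_sp (bigD1_seq #|A|) /= ?iota_uniq ?mem_index_iota //.
exact: addvSl.
Qed.

End CliffordFacts.

(** The two admissible fields of scalars, each with the real coordinates of its
    elements: F is spanned over R by 1 (and by i when F is complex). *)
Variant scalars := RealScalars | ComplexScalars.

Definition scal (R : realType) (s : scalars) : fieldType :=
  match s with
  | RealScalars => (R : fieldType)
  | ComplexScalars => (R[i] : fieldType)
  end.

Definition re_scal (R : realType) (s : scalars) : scal R s -> R :=
  match s return scal R s -> R with
  | RealScalars => fun z => z
  | ComplexScalars => fun z => complex.Re z
  end.

Definition im_scal (R : realType) (s : scalars) : scal R s -> R :=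
  match s return scal R s -> R with
  | RealScalars => fun _ => 0
  | ComplexScalars => fun z => complex.Im z
  end.

Definition mk_scal (R : realType) (s : scalars) (a b : R) : scal R s :=
  match s return scal R s with
  | RealScalars => a
  | ComplexScalars => complex.Complex a b
  end.

(** The unit vector of the coordinate x^mu of V = 'rV[R]_r. *)
Definition evec (R : realType) (r : nat) (mu : 'I_r) : 'rV[R]_r :=
  delta_mx 0 mu.

(** k times continuously differentiable, through iterated partial derivatives. *)
Fixpoint Ck (R : realType) (r : nat) (k : nat) (f : 'rV[R]_r -> R) : Prop :=
  continuous f /\
  match k with
  | 0 => True
  | k'.+1 => forall mu : 'I_r, (forall x, derivable f x (evec R mu)) /\
                               Ck k' (fun x => 'D_(evec R mu) f x)
  end.

Definition smooth (R : realType) (r : nat) (f : 'rV[R]_r -> R) : Prop :=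
  forall k, Ck k f.

Section CliffordCalculus.
Variables (R : realType) (s : scalars) (p q r : nat).
Implicit Types (f : 'rV[R]_r -> cliff (scal R s) p q).

Definition re_coord f (A : {set 'I_(p + q)}) (x : 'rV[R]_r) : R :=
  re_scal (coord_cl (f x) A).
Definition im_coord f (A : {set 'I_(p + q)}) (x : 'rV[R]_r) : R :=
  im_scal (coord_cl (f x) A).

Definition smooth_cl f : Prop :=
  forall A, smooth (re_coord f A) /\ smooth (im_coord f A).

Definition derivable_cl (mu : 'I_r) f (x : 'rV[R]_r) : Prop :=
  forall A, derivable (re_coord f A) x (evec R mu) /\
            derivable (im_coord f A) x (evec R mu).

Definition partial_cl (mu : 'I_r) f (x : 'rV[R]_r) : cliff (scal R s) p q :=
  [ffun A => mk_scal s ('D_(evec R mu) (re_coord f A) x)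
                       ('D_(evec R mu) (im_coord f A) x)].

(** The system d_mu S = C_mu S on V. The operator 'D is total, hence the
    explicit existence of the partial derivatives. *)
Definition solves_system (C : 'I_r -> 'rV[R]_r -> cliff (scal R s) p q) f :
  Prop :=
  forall mu x, derivable_cl mu f x /\ partial_cl mu f x = C mu x * f x.

End CliffordCalculus.

(* Main.v *)
(** Along any path, the system for S transports h(x) by conjugation, so the
    content of the theorem is that this transport is path independent. Comparing
    the two mixed derivatives of h shows that the curvature
    d_mu C_nu - d_nu C_mu - [C_mu, C_nu] commutes with every h^a(x); by Pauli's
    theorem the average of h^A Y (h^A)^-1 over all A is the central part of Y,
    and the curvature, built from N-valued terms and a commutator, has none:
    it vanishes. The same average gives
    2^n C_mu = sum_A (d_mu h^A) (h^A)^-1, whence C is smooth. The system is then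
    integrated one coordinate at a time by linear ordinary differential
    equations, flatness and Gronwall's inequality providing the derivatives with
    respect to the coordinates already treated. Finally S(x) intertwines h(x)
    and h(0), and Pauli's theorem at x = 0 provides K. *)
From HB Require Import structures.
Require Import Defs.
From mathcomp Require Import all_boot all_order all_algebra all_field.
From mathcomp Require Import complex.
From mathcomp Require Import all_classical all_reals all_analysis.
From mathcomp Require Import ring lra.
Import GRing.Theory.
Local Open Scope ring_scope.

Set Implicit Arguments.
Unset Strict Implicit.
Unset Printing Implicit Defensive.

(** * Pauli's theorem *)

Section CliffordSystems.
Variables (F : fieldType) (p q : nat).
Local Notation I := 'I_(p + q).
Local Notation Cl := (cliff F p q).
Implicit Types (A B D : {set I}) (X Y Z K L : Cl) (h g : I -> Cl).

(** An averaged intertwiner [intw h gen X] may vanish or be a zero divisor, so the difficulty in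
    Pauli's theorem is to find an invertible one. Summed over all basis elements, the products of
    two opposite intertwiners give a nonzero scalar, so one of these central products is nonzero.
    This is enough when the center is a field; for odd n the center may be a sum of two copies of F,
    and two intertwiners are then glued along its idempotents. For odd n the trace condition forces
    h^{1...n} to be e^{1...n} up to a sign b; the system b h^a agrees with the generators on the
    center, and b is the sign of the conclusion. In the integration, differentiability of the
    solutions in the coordinates already treated has to be proved. The derivative is guessed to be
    C_j S; the error of the resulting first order expansion solves a linear equation with a
    quadratically small source, so it is negligible. Linear equations must be solved on whole lines,
    as V is unbounded, which is the reason for an exponentially weighted norm. *)

Definition cliff_rel h : Prop :=
  forall a b, h a * h b + h b * h a = (2 * eta F p q a b) *: 1.

Definition bprod h A : Cl := \prod_(a < p + q | a \in A) h a.

(** The morphism e^a -> h^a of the universal property; it is multiplicative by [liftM]. *)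
Definition lift h X : Cl := \sum_A coord_cl X A *: bprod h A.

(* e^A e^A = sqsgn A e, so that sqsgn A *: e^A is the inverse of e^A. *)
Definition sqsgn A : F := sgn_cl F A A.

(* sum_B h^B X (g^B)^-1, an intertwiner of the systems h and g. *)
Definition intw h g X : Cl := \sum_B sqsgn B *: (bprod h B * X * bprod g B).

Definition avg X : Cl := intw (@gen_cl F p q) (@gen_cl F p q) X.

Lemma sgn_clK A B : sgn_cl F A B * sgn_cl F A B = 1.
Proof.
rewrite /sgn_cl -big_split big1 // => a _ /=.
by rewrite -big_split big1 // => b _; rewrite /= sgn1_cl_sqr.
Qed.

Lemma sqsgnK A : sqsgn A * sqsgn A = 1.
Proof. exact: sgn_clK. Qed.

Lemma symdiffC A B : symdiff A B = symdiff B A.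
Proof. by apply/setP=> x; rewrite !symdiffE addbC. Qed.

Lemma symdiffxx A : symdiff A A = finset.set0.
Proof. by apply/setP=> x; rewrite symdiffE addbb inE. Qed.

Lemma symdiffK A : involutive (symdiff A).
Proof. by move=> B; rewrite symdiffA symdiffxx symdiff0A. Qed.

Lemma basis_clM A B :
  basis_cl F A * basis_cl F B = sgn_cl F A B *: basis_cl F (symdiff A B).
Proof. exact: mul_basis_cl. Qed.

Lemma basis_cl0 : basis_cl F finset.set0 = 1 :> Cl.
Proof. by []. Qed.

Lemma basis_cl_sq A : basis_cl F A * basis_cl F A = sqsgn A *: 1.
Proof. by rewrite basis_clM symdiffxx. Qed.

Lemma bprod_gen A : bprod (@gen_cl F p q) A = basis_cl F A.
Proof. by rewrite basis_cl_prod. Qed.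

Lemma bprod0 h : bprod h finset.set0 = 1.
Proof. by rewrite /bprod big_pred0 // => a; rewrite inE. Qed.

Lemma full_prodE h : full_prod h = bprod h [set: _]%SET.
Proof. by apply: eq_bigl => a; rewrite inE. Qed.

Lemma lift_basis h A : lift h (basis_cl F A) = bprod h A.
Proof.
rewrite /lift (bigD1 A) //= big1 => [|B BA].
  by rewrite coord_basis_cl eqxx scale1r addr0.
by rewrite coord_basis_cl (negPf BA) scale0r.
Qed.

Lemma lift_linear h : linear (lift h).
Proof.
move=> c U W; rewrite /lift scaler_sumr -big_split; apply: eq_bigr => A _ /=.
by rewrite coord_clD coord_clZ scalerDl scalerA.
Qed.

Lemma lift0 h : lift h 0 = 0.
Proof. by rewrite /lift big1 // => A _; rewrite /coord_cl ffunE scale0r. Qed.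

Lemma lift1 h : lift h 1 = 1.
Proof. by rewrite -basis_cl0 lift_basis bprod0. Qed.

Lemma index_enum_ord_sorted m :
  sorted (fun a b : 'I_m => (a < b)%N) (index_enum 'I_m).
Proof.
have := iota_ltn_sorted 0 m.
by rewrite -val_enum_ord sorted_map enumT /index_enum; case: index_enum_key.
Qed.

Lemma gen_cl_rel : cliff_rel (@gen_cl F p q).
Proof. exact: gen_cl_mul. Qed.

Hypothesis two : (2%:R : F) != 0.

Section Rel.
Variable (h : I -> Cl).
Hypothesis hrel : cliff_rel h.

Lemma cliff_rel_anti a b : a != b -> h a * h b = - (h b * h a).
Proof.
move=> ab; apply/eqP; rewrite -addr_eq0 hrel etaE (negPf ab) mulr0 scale0r.
exact: eqxx.
Qed.

Lemma cliff_rel_sq a : h a * h a = eta F p q a a *: 1.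
Proof.
by apply: (scalerI two); rewrite scalerA -hrel scaler_nat mulr2n.
Qed.

(** Induction along the ordered list of indices: [h a] passes each smaller factor at the price of a
    sign, until it is inserted at its own place or merges with an equal factor there. *)
Lemma gen_bprod a B :
  h a * bprod h B =
  (\prod_(b in B) sgn1_cl F a b) *: bprod h (symdiff [set a]%SET B).
Proof.
have: a \in index_enum I by exact: mem_index_enum.
rewrite /bprod.
elim: (index_enum I) (index_enum_ord_sorted (p + q)) => [//|c l IHl] sl.
have ltr : transitive (fun a b : I => (a < b)%N).
  by move=> x y z; apply: ltn_trans.
have /allP cl : all (fun b : I => (c < b)%N) l by exact: (order_path_min ltr sl).
rewrite inE; case: (eqVneq a c) => [-> _|ac /= al].
  have ncl : forall b, b \in l -> b != c.
    by move=> b /cl; apply: contraTneq => ->; rewrite ltnn.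
  have E1 : \prod_(b <- l | b \in B) sgn1_cl F c b = 1.
    rewrite big_seq_cond big1 // => b /andP[bl _].
    by rewrite /sgn1_cl ltnNge (ltnW (cl _ bl)) /= eq_sym (negPf (ncl _ bl)).
  have E2 : \prod_(b <- l | b \in symdiff [set c]%SET B) h b =
            \prod_(b <- l | b \in B) h b.
    rewrite big_seq_cond [RHS]big_seq_cond; apply: eq_bigl => b.
    by case bl: (b \in l) => //=; rewrite symdiffE inE (negPf (ncl _ bl)).
  rewrite !big_cons E1 E2 symdiffE inE eqxx /=.
  case cB: (c \in B) => /=; last by rewrite scale1r.
  by rewrite mulrA cliff_rel_sq -scalerAl mul1r mulr1 /sgn1_cl ltnn eqxx.
have {}IHl := IHl (path_sorted sl) al.
rewrite !big_cons symdiffE inE eq_sym (negPf ac) /=.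
case: (c \in B) => //=.
rewrite mulrA cliff_rel_anti // mulNr -mulrA IHl -scalerAr.
by rewrite /sgn1_cl (cl _ al) mulN1r scaleNr.
Qed.

(** Basis elements are products of generators, so a generator as left factor is enough, and this
    case is [gen_bprod]. *)
Lemma liftM X Y : lift h (X * Y) = lift h X * lift h Y.
Proof.
have liftB A Z : lift h (basis_cl F A * Z) = lift h (basis_cl F A) * lift h Z.
  rewrite basis_cl_prod; move: Z.
  pose P U := forall Z, lift h (U * Z) = lift h U * lift h Z.
  apply: (@big_ind _ P) => [Z|U V PU PV Z|a _ Z]; rewrite /P.
  - by rewrite lift1 !mul1r.
  - by rewrite -mulrA PU PV [lift h (U * V)]PU mulrA.
  move: Z; apply: basis_cl_ext => [c U V|c U V|B].
  - by rewrite mulrDr -scalerAr lift_linear.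
  - by rewrite lift_linear mulrDr -scalerAr.
  rewrite /gen_cl !lift_basis basis_clM.
  have -> : bprod h [set a]%SET = h a.
    by rewrite /bprod (big_pred1 a) // => b; rewrite !inE.
  rewrite gen_bprod /sgn_cl big_set1.
  by have := lift_linear h (\prod_(b in B) sgn1_cl F a b)
      (basis_cl F (symdiff [set a]%SET B)) 0; rewrite addr0 lift0 addr0 lift_basis.
move: X; apply: basis_cl_ext => [c U V|c U V|A]; last exact: liftB.
- by rewrite mulrDl -scalerAl lift_linear.
- by rewrite lift_linear mulrDl -scalerAl.
Qed.

Lemma bprodM A B : bprod h A * bprod h B = sgn_cl F A B *: bprod h (symdiff A B).
Proof.
rewrite -!lift_basis -liftM basis_clM.
have := lift_linear h (sgn_cl F A B) (basis_cl F (symdiff A B)) 0.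
by rewrite !addr0 lift0 addr0.
Qed.

Lemma bprod_sq A : bprod h A * bprod h A = sqsgn A *: 1.
Proof. by rewrite bprodM symdiffxx bprod0. Qed.

End Rel.

(** Multiplication by h^A permutes the summands through B -> [symdiff A B]; the signs match because
    [sgn_cl] is multiplicative in each argument and squares to 1. *)
Lemma intwl h g X A : cliff_rel h -> cliff_rel g ->
  bprod h A * intw h g X = intw h g X * bprod g A.
Proof.
move=> hr gr; rewrite /intw mulr_sumr mulr_suml.
rewrite [RHS](reindex_inj (can_inj (symdiffK A))) /=; apply: eq_bigr => B _.
rewrite -scalerAr -scalerAl !mulrA (bprodM hr).
rewrite -(mulrA _ (bprod g _) (bprod g _)) (bprodM gr).
rewrite -!scalerAl -scalerAr !scalerA (symdiffC _ A) symdiffK.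
congr (_ *: _); rewrite /sqsgn !sgn_clDr !sgn_clDl.
by rewrite -[LHS]mulr1 -(sgn_clK B A) -[LHS]mulr1 -(sgn_clK A A); ring.
Qed.

(** Each h^B of the left factor passes through the intertwiner on its right and comes out as k^B. *)
Lemma intw_comp h g k X Y : cliff_rel h -> cliff_rel k ->
  intw g h Y * intw h k X = intw g k (Y * intw h k X).
Proof.
move=> hr kr; have HK B := @intwl h k X B hr kr.
move: (intw h k X) HK => K HK; rewrite /intw mulr_suml; apply: eq_bigr => B _.
by rewrite -scalerAl -!mulrA HK.
Qed.

Lemma intw_linear h g : linear (intw h g).
Proof.
move=> c U W; rewrite /intw scaler_sumr -big_split; apply: eq_bigr => B _ /=.
rewrite mulrDr mulrDl scalerDr -scalerAr -scalerAl !scalerA.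
by rewrite (mulrC (sqsgn B)).
Qed.

Lemma intw0 h g : intw h g 0 = 0.
Proof. by rewrite /intw big1 // => B _; rewrite mulr0 mul0r scaler0. Qed.

Lemma intwZ h g c X : intw h g (c *: X) = c *: intw h g X.
Proof. by have := intw_linear h g c X 0; rewrite intw0 !addr0. Qed.

Lemma avgZ c X : avg (c *: X) = c *: avg X.
Proof. exact: intwZ. Qed.

(** A symmetric bicharacter on index sets under [symdiff]; its sums therefore obey character
    orthogonality. *)
Definition comsgn A B : F := sgn_cl F A B * sgn_cl F B A.

Definition central_ix A := [forall b, comsgn A [set b]%SET == 1].

Lemma basis_cl_com A B :
  basis_cl F A * basis_cl F B = comsgn A B *: (basis_cl F B * basis_cl F A).
Proof.
by rewrite !basis_clM scalerA /comsgn -mulrA sgn_clK mulr1 (symdiffC B).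
Qed.

Lemma comsgnC A B : comsgn A B = comsgn B A.
Proof. by rewrite /comsgn mulrC. Qed.

Lemma comsgnDr A B D : comsgn A (symdiff B D) = comsgn A B * comsgn A D.
Proof. by rewrite /comsgn sgn_clDr sgn_clDl mulrACA. Qed.


Lemma comsgn1 A b : comsgn A [set b]%SET = (-1) ^+ #|A :\ b|.
Proof.
rewrite /comsgn /sgn_cl big_set1 -big_split /=.
have E : forall a, (\prod_(c in [set b]%SET) sgn1_cl F a c) * sgn1_cl F b a =
                   if a == b then 1 else -1.
  move=> a; rewrite big_set1 /sgn1_cl (eq_sym b); case: (eqVneq a b) => [->|ab].
    by rewrite ltnn etaE eqxx; case: ifP => _; rewrite ?mulrNN mulr1.
  by case: (ltngtP a b) => [||/val_inj/eqP]; rewrite ?mulr1 ?mul1r // (negPf ab).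
rewrite (eq_bigr _ (fun a _ => E a)) -prodr_const big_mkcond [RHS]big_mkcond.
apply: eq_bigr => a _; rewrite !inE.
by case: (a \in A); rewrite ?andbF //= andbT; case: eqP.
Qed.

(** Commuting with e^b means that A without b has even size. For all b this says that b is in A
    exactly when A has odd size, so A is empty, or full with n odd. *)
Lemma central_ixP A :
  reflect (A = finset.set0 \/ odd (p + q) /\ A = [set: _]%SET) (central_ix A).
Proof.
have m1 : (-1 : F) != 1.
  by apply: contra two => /eqP m; rewrite mulr2n -{1}m addNr.
have cE B b : (comsgn B [set b]%SET == 1) = ~~ odd #|B :\ b|.
  by rewrite comsgn1 -signr_odd; case: (odd _); rewrite ?expr1 ?(negPf m1) ?eqxx.
have cardA b : #|A| = ((b \in A) + #|A :\ b|)%N by exact: cardsD1.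
apply: (iffP forallP) => [H|[->|[on ->]] b].
- have H' b : odd #|A| = (b \in A).
    by have := H b; rewrite cE (cardA b) oddD oddb => /negPf ->; rewrite addbF.
  case oA : (odd #|A|).
    right; have AT : A = [set: _]%SET by apply/setP => b; rewrite inE -H' oA.
    by split=> //; rewrite AT cardsT card_ord in oA.
  by left; apply/setP => b; rewrite inE -H' oA.
- by rewrite cE finset.set0D cards0.
- rewrite cE; move: (cardsD1 b [set: I]%SET); rewrite cardsT card_ord inE.
  by move=> /(congr1 odd); rewrite on oddD /=; case: (odd _).
Qed.


Lemma comsgn_prod A B : comsgn A B = \prod_(b in B) comsgn A [set b]%SET.
Proof.
rewrite /comsgn big_split /=; congr (_ * _).
  rewrite /sgn_cl exchange_big /=; apply: eq_bigr => b _.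
  by apply: eq_bigr => a _; rewrite big_set1.
by apply: eq_bigr => b _; rewrite /sgn_cl big_set1.
Qed.

Lemma central_comsgn A B : central_ix A -> comsgn A B = 1.
Proof.
by move=> /forallP cA; rewrite comsgn_prod big1 // => b _; apply/eqP.
Qed.


(** Conjugation by e^B multiplies e^A by [comsgn A B], and a nontrivial character sums to zero:
    toggling a suitable index b multiplies the sum by a factor other than 1. *)
Lemma avg_basis A : avg (basis_cl F A) =
  (if central_ix A then (2 ^ (p + q))%:R else 0) *: basis_cl F A.
Proof.
have -> : avg (basis_cl F A) = (\sum_B comsgn A B) *: basis_cl F A.
  rewrite scaler_suml; apply: eq_bigr => B _; rewrite !bprod_gen.
  rewrite -mulrA basis_cl_com -scalerAr mulrA basis_cl_sq -scalerAl mul1r.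
  rewrite !scalerA; congr (_ *: _).
  by rewrite -[RHS]mulr1 -(sqsgnK B); ring.
congr (_ *: _); case: ifPn => [cA|].
  under eq_bigr do rewrite central_comsgn //.
  by rewrite sumr_const -cardsT -powersetT card_powerset cardsT card_ord.
move=> /forallPn[b]; set c := comsgn _ _ => c1.
have : \sum_B comsgn A B = c * \sum_B comsgn A B.
  rewrite mulr_sumr (reindex_inj (can_inj (symdiffK [set b]%SET))) /=.
  by apply: eq_bigr => B _; rewrite comsgnDr.
move/eqP; rewrite -subr_eq0 -{1}[\sum__ _]mul1r -mulrBl mulf_eq0 subr_eq0.
by rewrite eq_sym (negPf c1) => /eqP.
Qed.

Lemma avg_com X Y : avg X * Y = Y * avg X.
Proof.
move: Y; apply: basis_cl_ext => [c U V|c U V|A].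
- by rewrite mulrDr -scalerAr.
- by rewrite mulrDl -scalerAl.
by rewrite -bprod_gen intwl //; exact: gen_cl_rel.
Qed.

(** On basis elements only a central [symdiff A B] contributes, and in that case e^A and e^B
    commute. *)
Lemma avg_mulC X Y : avg (X * Y) = avg (Y * X).
Proof.
move: X; apply: basis_cl_ext => [c U V|c U V|A].
- by rewrite mulrDl -scalerAl /avg intw_linear.
- by rewrite mulrDr -scalerAr /avg intw_linear.
move: Y; apply: basis_cl_ext => [c U V|c U V|B].
- by rewrite mulrDr -scalerAr /avg intw_linear.
- by rewrite mulrDl -scalerAl /avg intw_linear.
rewrite !basis_clM !avgZ avg_basis (symdiffC B A) avg_basis.
case: ifP => [cD|]; last by rewrite !scale0r !scaler0.
congr (_ *: _); rewrite -[LHS]mulr1 -(sgn_clK B A) mulrA.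
have -> : sgn_cl F A B * sgn_cl F B A = comsgn A (symdiff A (symdiff A B)).
  by rewrite symdiffK.
by rewrite comsgnDr (comsgnC A (symdiff A B)) (central_comsgn _ cD) /comsgn sgn_clK !mul1r.
Qed.

End CliffordSystems.

(** * Invertible intertwiners of Clifford systems *)

Section Pauli.
Variables (F : fieldType) (p q : nat).
Local Notation I := 'I_(p + q).
Local Notation Cl := (cliff F p q).
Local Notation gen := (@gen_cl F p q).
Local Notation eT := (basis_cl F [set: I]%SET).
Local Notation tau := (sqsgn F [set: I]%SET).
Implicit Types (A B D : {set I}) (X Y Z K L : Cl) (h g : I -> Cl).

Hypothesis two : (2%:R : F) != 0.

(** Finite dimension: left multiplication by K is injective, hence onto, which yields a right
    inverse. *)
Lemma left_inverse_unit K L : L * K = 1 -> K \is a GRing.unit.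
Proof.
move=> LK; have inj : lker (amull K) == 0%VS.
  apply/lker0P => X Y; rewrite !lfunE /= => /(congr1 (fun Z => L * Z)).
  by rewrite !mulrA LK !mul1r.
move: (lker0_lfunVK inj 1); rewrite lfunE /=; move: (fun_of_lfun _ 1) => M KM.
have ML : M = L by rewrite -[RHS]mulr1 -KM mulrA LK mul1r.
by apply/unitrP; exists L; split=> //; rewrite -{1}ML.
Qed.

Lemma avg0 : avg (0 : Cl) = 0.
Proof. exact: intw0. Qed.

Lemma avgD X Y : avg (X + Y) = avg X + avg Y.
Proof.
have := intw_linear gen gen 1 X Y.
by rewrite -/(avg _) !scale1r => ->; rewrite -!/(avg _).
Qed.

Lemma avg_sum (J : Type) (r : seq J) (P : pred J) (f : J -> Cl) :
  avg (\sum_(i <- r | P i) f i) = \sum_(i <- r | P i) avg (f i).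
Proof. exact: (big_morph _ avgD avg0). Qed.

Lemma avgE X : avg X =
  (2 ^ (p + q))%:R *: \sum_(A | central_ix F A) coord_cl X A *: basis_cl F A.
Proof.
rewrite {1}(cliffE X) avg_sum scaler_sumr [RHS]big_mkcond; apply: eq_bigr => A _.
rewrite avgZ avg_basis; case: ifP => _; last by rewrite scale0r scaler0.
by rewrite !scalerA mulrC.
Qed.

Lemma avg_eq0 X : (forall A, central_ix F A -> coord_cl X A = 0) -> avg X = 0.
Proof.
by move=> X0; rewrite avgE big1 ?scaler0 // => A /X0 ->; rewrite scale0r.
Qed.

Lemma central_ix0 : central_ix F (finset.set0 : {set I}).
Proof. by apply/(central_ixP two); left. Qed.

Lemma setT_neq0 : odd (p + q) -> [set: I]%SET != finset.set0.
Proof.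
move=> on; apply/eqP => /(congr1 (fun A => #|pred_of_set A|)).
by rewrite cardsT card_ord cards0 => E; rewrite E in on.
Qed.

Lemma avg_center X : exists ab : F * F,
  avg X = ab.1 *: 1 + ab.2 *: eT /\ (~~ odd (p + q) -> ab.2 = 0).
Proof.
rewrite avgE (bigD1 finset.set0) ?central_ix0 //=.
have [on|en] := boolP (odd (p + q)); last first.
  rewrite big1 => [|A /andP[/(central_ixP two)[-> /eqP//|[]]]]; last first.
    by rewrite (negPf en).
  exists ((2 ^ (p + q))%:R * coord_cl X finset.set0, 0); split=> //=.
  by rewrite scale0r !addr0 scalerA.
rewrite (bigD1 [set: I]%SET) /=; last first.
  by rewrite setT_neq0 // andbT; apply/(central_ixP two); right.
rewrite big1 => [|A]; last first.
  by move=> /andP[/andP[/(central_ixP two)[->|[_ ->]]]]; rewrite eqxx.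
exists ((2 ^ (p + q))%:R * coord_cl X finset.set0,
        (2 ^ (p + q))%:R * coord_cl X [set: I]%SET); split=> //=.
by rewrite addr0 scalerDr !scalerA.
Qed.

Lemma pow2_neq0 m : ((2 ^ m)%:R : F) != 0.
Proof. by rewrite natrX expf_neq0. Qed.

Lemma avg1 : avg (1 : Cl) = (2 ^ (p + q))%:R *: 1.
Proof. by rewrite -basis_cl0 avg_basis central_ix0. Qed.

Lemma span1TM (a b c d : F) : (a *: 1 + b *: eT) * (c *: 1 + d *: eT) =
  (a * c + b * d * tau) *: 1 + (a * d + b * c) *: eT.
Proof.
rewrite mulrDl !mulrDr -!scalerAl !mul1r -!scalerAr mulr1 basis_cl_sq !scalerA.
by rewrite [X in _ + X]addrC addrACA -!scalerDl.
Qed.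

(** With e and e' complementary central idempotents, a left inverse is assembled from l^-1 L on one
    ideal and l'^-1 L' on the other. *)
Lemma split_unit K K' L L' e e' (l l' : F) :
  (forall X, e * X = X * e) -> (forall X, e' * X = X * e') ->
  e * e = e -> e' * e' = e' -> e * e' = 0 -> e + e' = 1 ->
  l != 0 -> l' != 0 -> L * K * e = l *: e -> L' * K' * e' = l' *: e' ->
  K * e + K' * e' \is a GRing.unit.
Proof.
move=> eC e'C ee e'e' ee' e1 l0 l'0 lE l'E.
apply: (@left_inverse_unit _ (l^-1 *: (e * L) + l'^-1 *: (e' * L'))).
have P1 : e * L * (K * e) = l *: e by rewrite -mulrA (mulrA L K e) lE -scalerAr ee.
have P2 : e * L * (K' * e') = 0.
  by rewrite (eC L) -mulrA (mulrA e K' e') (eC K') -(mulrA K') ee' !mulr0.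
have P3 : e' * L' * (K * e) = 0.
  by rewrite (e'C L') -mulrA (mulrA e' K e) (e'C K) -(mulrA K) (e'C e) ee' !mulr0.
have P4 : e' * L' * (K' * e') = l' *: e'.
  by rewrite -mulrA (mulrA L' K' e') l'E -scalerAr e'e'.
rewrite mulrDl !mulrDr -!scalerAl P1 P2 P3 P4 !scaler0 addr0 add0r.
by rewrite !scalerA !mulVf // !scale1r.
Qed.

Section Intertwiner.
Variable h : I -> Cl.
Hypothesis hrel : cliff_rel h.
Hypothesis hcentral : forall A, central_ix F A -> bprod h A = basis_cl F A.

Let KK B := intw h gen (basis_cl F B).
Let LL B := intw gen h (sqsgn F B *: basis_cl F B).

Let LLKK B D : LL B * KK D = avg (sqsgn F B *: basis_cl F B * KK D).
Proof. by rewrite /LL /KK intw_comp //; exact: gen_cl_rel. Qed.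

(** After a cyclic permutation under [avg], the sum over B collapses to the terms h^A (e^A)^-1 with
    A central. By [hcentral] these all equal 1, so nothing cancels, and some [LL B * KK B] is
    nonzero. *)
Let sumKK : exists2 c : F, c != 0 & \sum_B LL B * KK B = c *: 1.
Proof.
exists ((2 ^ (p + q))%:R * ((2 ^ (p + q))%:R * (#|central_ix F (p:=p) (q:=q)|)%:R)).
  rewrite !mulf_neq0 ?pow2_neq0 //.
  have [on|en] := boolP (odd (p + q)).
    suff -> : #|central_ix F (p:=p) (q:=q)| = 2%N by [].
    have := cards2 [set: I]%SET finset.set0; rewrite setT_neq0 // => <-.
    apply: eq_card => A.
    rewrite !inE; apply/(central_ixP two)/orP => [[->|[_ ->]]|[]/eqP ->].
    - by right.
    - by left.
    - by right.
    - by left.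
  suff -> : #|central_ix F (p:=p) (q:=q)| = 1%N by rewrite oner_eq0.
  rewrite -(cards1 (finset.set0 : {set I})); apply: eq_card => A.
  rewrite inE; apply/(central_ixP two)/eqP => [[->//|[]]|->]; last by left.
  by rewrite (negPf en).
under eq_bigr do rewrite LLKK avg_mulC -scalerAr scalerAl.
rewrite -avg_sum.
have -> : \sum_B (sqsgn F B *: KK B) * basis_cl F B =
    ((2 ^ (p + q))%:R * (#|central_ix F (p:=p) (q:=q)|)%:R) *: 1.
  transitivity (\sum_A sqsgn F A *: (bprod h A * avg (basis_cl F A))).
    under [RHS]eq_bigr do rewrite /avg /intw mulr_sumr scaler_sumr.
    rewrite [RHS]exchange_big /=; apply: eq_bigr => B _.
    rewrite /KK /intw scaler_sumr mulr_suml; apply: eq_bigr => A _.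
    rewrite !bprod_gen -!scalerAl -scalerAr !scalerA !mulrA.
    by rewrite (mulrC (sqsgn _ _)).
  rewrite -scalerA [X in _ *: X]scaler_nat -sumr_const scaler_sumr [RHS]big_mkcond.
  apply: eq_bigr => A _; rewrite avg_basis.
  rewrite -[A \in _]/(central_ix F A); case: ifP => [cA|]; last first.
    by rewrite scale0r mulr0 scaler0.
  rewrite hcentral // -scalerAr basis_cl_sq !scalerA mulrAC.
  by rewrite (sqsgnK F A) mul1r.
by rewrite avgZ avg1 scalerA mulrC.
Qed.

Lemma intertwiner_exists :
  exists2 K, K \is a GRing.unit & forall a, h a * K = K * gen a.
Proof.
have hK X a : h a * intw h gen X = intw h gen X * gen a.
  have := intwl two X [set a]%SET hrel (@gen_cl_rel F p q).
  by rewrite bprod_gen /bprod (big_pred1 a) // => b; rewrite !inE.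
have [c c0 cE] := sumKK.
have zE B : exists ab : F * F, LL B * KK B = ab.1 *: 1 + ab.2 *: eT /\
    (~~ odd (p + q) -> ab.2 = 0).
  by rewrite LLKK; exact: avg_center.
have eTT : eT * eT = tau *: 1 by exact: basis_cl_sq.
have tau0 : tau != 0.
  apply/eqP => t0; have := sqsgnK F [set: I]%SET.
  by rewrite t0 mul0r => /esym/eqP; rewrite oner_eq0.
have unitK B : LL B * KK B \is a GRing.unit -> KK B \is a GRing.unit.
  by move=> u; apply: (@left_inverse_unit _ ((LL B * KK B)^-1 * LL B)); rewrite -mulrA mulVr.
(* Unless n is odd and [tau] is a square in F, the center is a field, so a nonzero central
   [LL B * KK B] is invertible. *)
have [[on [d dd]]|nsplit] := pselect (odd (p + q) /\ exists d : F, d * d = tau); last first.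
  have [B zB] : exists B, LL B * KK B != 0.
    apply/existsP; apply: contraT => /existsPn z0; move: cE.
    rewrite big1 => [/eqP|B _]; last by apply/eqP; have := z0 B; rewrite negbK.
    by rewrite eq_sym scaler_eq0 (negPf c0) oner_eq0.
  exists (KK B); last by move=> a; apply: hK.
  apply: unitK; have [[x y] /= [zxy y0]] := zE B.
  (* The norm of x + y eT: were it zero with y nonzero, x / y would be a square root of [tau]. *)
  have nz : x * x - y * y * tau != 0.
    apply/eqP => /eqP; rewrite subr_eq0 => /eqP xy.
    have [y00|yn0] := eqVneq y 0.
      move: xy zB; rewrite zxy y00 !mul0r => /eqP; rewrite mulf_eq0 orbb => /eqP ->.
      by rewrite !scale0r addr0 eqxx.
    apply: nsplit; split.
      by apply: contraT => /y0 yy; rewrite yy eqxx in yn0.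
    exists (x / y); rewrite mulf_div xy mulrC mulKf //.
    by rewrite mulf_neq0.
  apply: (@left_inverse_unit _ ((x * x - y * y * tau)^-1 *: (x *: 1 - y *: eT))).
  rewrite zxy -scalerAl -scaleNr span1TM.
  have -> : x * y + - y * x = 0 by ring.
  have -> : x * x + - y * y * tau = x * x - y * y * tau by ring.
  by rewrite scale0r addr0 scalerA mulVf // scale1r.
have eTC X : eT * X = X * eT.
  have := avg_com two eT X; rewrite avg_basis.
  have -> : central_ix F [set: I]%SET by apply/(central_ixP two); right.
  by rewrite -scalerAl -scalerAr => /(scalerI (pow2_neq0 _)).
have d0 : d != 0 by apply: contraNneq tau0 => d0; rewrite -dd d0 mul0r.
(* When the square of eT has a square root d in F, the center splits into two
   ideals; an invertible intertwiner is assembled from one on each ideal. *)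
pose ep s : Cl := 2^-1 *: 1 + (2^-1 * (s / d)) *: eT.
have epC s X : ep s * X = X * ep s.
  by rewrite /ep mulrDl mulrDr -!scalerAl -!scalerAr mul1r mulr1 eTC.
have epM s (x y : F) : s * s = 1 ->
    (x *: 1 + y *: eT) * ep s = (x + s * y * d) *: ep s.
  move=> ss; rewrite /ep span1TM scalerDr !scalerA -dd; congr (_ *: _ + _ *: _).
    by field; rewrite ?d0 ?two.
  have -> : (x + s * y * d) * (2^-1 * (s / d)) = x * (2^-1 * (s / d)) + y * (2^-1 * (s * s)).
    by field; rewrite ?d0 ?two.
  by rewrite ss mulr1.
have epE s : s * s = 1 -> exists2 B, exists2 l, l != 0 &
    LL B * KK B * ep s = l *: ep s & True.
  move=> ss.
  have [B zB] : exists B, LL B * KK B * ep s != 0.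
    apply/existsP; apply: contraT => /existsPn z0; move: cE.
    move=> /(congr1 (fun Z => Z * ep s)); rewrite mulr_suml.
    rewrite big1 => [|B _]; last by apply/eqP; have := z0 B; rewrite negbK.
    rewrite -scalerAl mul1r => /esym/eqP; rewrite scaler_eq0 (negPf c0) /=.
    move=> /eqP/(congr1 (fun Z : Cl => coord_cl Z finset.set0)).
    rewrite /ep coord_clD !coord_clZ -basis_cl0 !coord_basis_cl eqxx.
    rewrite eq_sym (negPf (setT_neq0 on)) mulr1 mulr0 addr0 /coord_cl ffunE.
    by move=> /eqP; rewrite invr_eq0 (negPf two).
  exists B => //; have [[x y] /= [zxy _]] := zE B.
  exists (x + s * y * d); last by rewrite zxy epM.
  by apply: contraNneq zB => l0; rewrite zxy epM // l0 scale0r.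
have ss1 : 1 * 1 = 1 :> F by rewrite mul1r.
have ss2 : -1 * -1 = 1 :> F by rewrite mulrNN mul1r.
have [B [l l0 lE] _] := epE _ ss1; have [B' [l' l'0 l'E] _] := epE _ ss2.
have epp : ep 1 * ep 1 = ep 1.
  rewrite [X in X * _]/ep epM // -[RHS]scale1r; congr (_ *: _).
  by field; rewrite ?d0 ?two.
have emm : ep (-1) * ep (-1) = ep (-1).
  rewrite [X in X * _]/ep epM // -[RHS]scale1r; congr (_ *: _).
  by field; rewrite ?d0 ?two.
have epm : ep 1 * ep (-1) = 0.
  rewrite [X in X * _]/ep epM // -[RHS](scale0r (ep (-1))); congr (_ *: _).
  by field; rewrite ?d0 ?two.
have emp : ep (-1) * ep 1 = 0 by rewrite epC.
have ep1 : ep 1 + ep (-1) = 1.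
  rewrite /ep addrACA -!scalerDl -[RHS](scale1r 1) -[RHS]addr0.
  congr (_ *: _ + _); first by field; rewrite two.
  rewrite -[RHS](scale0r eT); congr (_ *: _).
  by field; rewrite ?d0 ?two.
exists (KK B * ep 1 + KK B' * ep (-1)); last first.
  move=> a; move: (hK (basis_cl F B) a) (hK (basis_cl F B') a) (epC 1 (gen a)) (epC (-1) (gen a)).
  rewrite -/(KK B) -/(KK B'); move: (KK B) (KK B') (ep 1) (ep (-1)) => U V e e' hU hV eC e'C.
  by rewrite mulrDr mulrDl !mulrA hU hV -!mulrA eC e'C.
exact: (split_unit (epC 1) (epC (-1)) epp emm epm ep1 l0 l'0 lE l'E).
Qed.

End Intertwiner.

(** For odd n the relations alone allow h^{1...n} to be a scalar, which would give [lift h] a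
    kernel; the trace condition excludes this. *)
Lemma lift_inj h : cliff_rel h ->
  (odd (p + q) -> Tr_cl (full_prod h) = 0) -> injective (lift h).
Proof.
move=> hrel hTr.
have liftD X Y : lift h (X + Y) = lift h X + lift h Y.
  by have := lift_linear h 1 X Y; rewrite !scale1r.
have liftZ c X : lift h (c *: X) = c *: lift h X.
  by have := lift_linear h c X 0; rewrite lift0 !addr0.
have Tr1 : Tr_cl (1 : Cl) = 1.
  rewrite /Tr_cl /grade_proj (bigD1 finset.set0) ?cards0 //= big1 => [|A].
    by rewrite -basis_cl0 coord_basis_cl eqxx scale1r addr0.
  by rewrite cards_eq0 => /andP[->].
have TrD X Y : Tr_cl (X + Y) = Tr_cl X + Tr_cl Y.
  rewrite /Tr_cl /grade_proj -big_split; apply: eq_bigr => A _ /=.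
  by rewrite coord_clD scalerDl.
have TrZ c X : Tr_cl (c *: X) = c *: Tr_cl X.
  rewrite /Tr_cl /grade_proj scaler_sumr; apply: eq_bigr => A _ /=.
  by rewrite coord_clZ scalerA.
have avgh X : lift h (avg X) = intw h h (lift h X).
  rewrite /avg /intw (big_morph _ liftD (lift0 h)); apply: eq_bigr => B _.
  by rewrite liftZ !(liftM two) // !bprod_gen lift_basis.
(* Averaging isolates the central terms of lift h X, and the trace condition
   separates 1 from full_prod h when n is odd. *)
have coord0 X : lift h X = 0 -> coord_cl X finset.set0 = 0.
  move=> X0; have := avgh X; rewrite X0 intw0.
  have -> : avg X = (2 ^ (p + q))%:R *:
      (coord_cl X finset.set0 *: 1 + (odd (p + q))%:R *: (coord_cl X [set: I]%SET *: eT)).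
    rewrite avgE (bigD1 finset.set0) ?central_ix0 //= -basis_cl0.
    congr (_ *: (_ + _)); have [on|en] := boolP (odd (p + q)).
      rewrite (bigD1 [set: I]%SET) /=; last first.
        by rewrite setT_neq0 // andbT; apply/(central_ixP two); right.
      rewrite big1 ?addr0 ?scale1r // => A.
      by move=> /andP[/andP[/(central_ixP two)[->|[_ ->]]]]; rewrite eqxx.
    rewrite big1 ?scale0r // => A /andP[/(central_ixP two)[-> /eqP//|[]]].
    by rewrite (negPf en).
  rewrite liftZ => /eqP; rewrite scaler_eq0 (negPf (pow2_neq0 _)) /=.
  rewrite liftD !liftZ lift1 lift_basis -full_prodE.
  move=> /eqP/(congr1 (@Tr_cl F p q)); rewrite TrD !TrZ Tr1.
  have -> : Tr_cl (0 : Cl) = 0 by have := TrZ 0 0; rewrite !scale0r.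
  have [on|en] := boolP (odd (p + q)); last rewrite scale0r addr0.
    rewrite hTr // !scaler0 addr0.
    by move=> /eqP; rewrite scaler_eq0 oner_eq0 orbF => /eqP.
  by move=> /eqP; rewrite scaler_eq0 oner_eq0 orbF => /eqP.
(* Multiplication by e^A moves the coordinate at A, up to a sign, to the place of 1, where [coord0]
   applies. *)
have ker0 X : lift h X = 0 -> X = 0.
  move=> X0; apply: cliffP => A.
  have := coord0 (basis_cl F A * X); rewrite (liftM two) // X0 mulr0 => /(_ erefl).
  rewrite {1}(cliffE X) mulr_sumr coord_cl_sum (bigD1 A) //= big1 => [|B BA].
    rewrite addr0 -scalerAr basis_cl_sq !coord_clZ -basis_cl0 coord_basis_cl eqxx mulr1.
    move=> /eqP; rewrite mulf_eq0 => /orP[/eqP ->|]; first by rewrite /coord_cl ffunE.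
    move=> /eqP s0; have := sqsgnK F A; rewrite s0 mul0r => /esym/eqP.
    by rewrite oner_eq0.
  rewrite -scalerAr basis_clM !coord_clZ coord_basis_cl.
  case: eqP => [E|]; last by rewrite !mulr0.
  by move: BA; rewrite -(symdiffK A B) -E symdiffA0 eqxx.
move=> X Y XY; apply/eqP; rewrite -subr_eq0; apply/eqP/ker0.
by rewrite -scaleN1r liftD liftZ XY scaleN1r subrr.
Qed.

End Pauli.

Section PauliTheorem.
Variables (F : fieldType) (p q : nat).
Local Notation I := 'I_(p + q).
Local Notation Cl := (cliff F p q).
Local Notation gen := (@gen_cl F p q).
Local Notation eT := (basis_cl F [set: I]%SET).
Implicit Types (A B D : {set I}) (X Y Z K L : Cl) (h g : I -> Cl).

Hypothesis two : (2%:R : F) != 0.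

Lemma bprodZ h b A : bprod (fun a => b *: h a) A = b ^+ #|A| *: bprod h A.
Proof. by rewrite /bprod scaler_prod prodr_const. Qed.

Lemma bprod_intertwine h g K A : (forall a, h a * K = K * g a) ->
  bprod h A * K = K * bprod g A.
Proof.
move=> hK; apply: (big_ind2 (fun u v => u * K = K * v)) => [|u v u' v' uv uv'|a _].
- by rewrite mulr1 mul1r.
- by rewrite -mulrA uv' mulrA uv mulrA.
- exact: hK.
Qed.

(** By dimension the injective [lift h] is onto, so h^{1...n}, the image of a central element, is
    central: it is u + v e^{1...n}. The trace condition kills u, and comparison of squares gives v^2
    = 1. *)
Lemma full_prod_sign h : cliff_rel h ->
  odd (p + q) -> Tr_cl (full_prod h) = 0 ->
  full_prod h = eT \/ full_prod h = - eT.
Proof.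
move=> hrel on hTr; have inj := @lift_inj F p q two h hrel (fun _ => hTr).
pose f : {linear Cl -> Cl} :=
  HB.pack (lift h) (GRing.isLinear.Build _ _ _ _ _ (lift_linear h)).
have kf : lker (linfun f) == 0%VS.
  by apply/lker0P => X Y; rewrite !lfunE /=; apply: inj.
have surj Y : exists X, lift h X = Y.
  exists ((linfun f)^-1%VF Y).
  by have := lker0_lfunVK kf Y; rewrite lfunE.
have cT : central_ix F [set: I]%SET by apply/(central_ixP two); right.
have TE : avg eT = (2 ^ (p + q))%:R *: eT by rewrite avg_basis cT.
have eTC X : eT * X = X * eT.
  have := avg_com two eT X; rewrite TE.
  by rewrite -scalerAl -scalerAr => /(scalerI (pow2_neq0 two _)).
have hTE : full_prod h = lift h eT by rewrite lift_basis full_prodE.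
have hTC X : full_prod h * X = X * full_prod h.
  by have [Y <-] := surj X; rewrite hTE -!(liftM two hrel) eTC.
have aE : avg (full_prod h) = (2 ^ (p + q))%:R *: full_prod h.
  rewrite -[RHS]mulr1 -scalerAl scalerAr -(avg1 _ _ two) mulr_sumr.
  by apply: eq_bigr => B _; rewrite -scalerAr mulr1 mulrA hTC.
have [[x y] /= [xyE _]] := avg_center two (full_prod h).
pose u := (2 ^ (p + q))%:R^-1 * x; pose v := (2 ^ (p + q))%:R^-1 * y.
have hE : full_prod h = u *: 1 + v *: eT.
  apply: (scalerI (pow2_neq0 two (p + q))).
  by rewrite -aE xyE scalerDr !scalerA !mulrA mulfV ?pow2_neq0 // !mul1r.
have u0 : u = 0.
  have := congr1 (fun Z => coord_cl Z finset.set0) hTr.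
  rewrite /Tr_cl /grade_proj coord_cl_sum (bigD1 finset.set0) ?cards0 //= big1.
    rewrite addr0 coord_clZ hE coord_clD !coord_clZ -basis_cl0 !coord_basis_cl.
    rewrite eqxx eq_sym (negPf (setT_neq0 on)) !mulr1 mulr0 addr0.
    by rewrite /coord_cl ffunE.
  by move=> A; rewrite cards_eq0 => /andP[->].
have : full_prod h * full_prod h = eT * eT.
  by rewrite full_prodE (bprod_sq two hrel) basis_cl_sq.
rewrite hE u0 scale0r add0r -scalerAl -scalerAr scalerA basis_cl_sq scalerA.
move=> /(congr1 (fun Z => coord_cl Z finset.set0)).
rewrite !coord_clZ -basis_cl0 coord_basis_cl eqxx !mulr1.
move=> E; have : v * v == 1.
  by rewrite -[v * v]mulr1 -(sqsgnK F [set: I]%SET) mulrA E.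
rewrite -expr2 sqrf_eq1 => /orP[]/eqP ->; [left|right]; first by rewrite scale1r.
by rewrite scaleN1r.
Qed.

Lemma pauli_theorem h : cliff_rel h -> (odd (p + q) -> Tr_cl (full_prod h) = 0) ->
  exists b K, [/\ b = 1 \/ b = -1, (~~ odd (p + q) -> b = 1), K \is a GRing.unit,
    (forall a, h a * K = K * (b *: gen a)) &
    (odd (p + q) -> full_prod h = b *: full_prod gen)].
Proof.
move=> hrel hTr.
have [b [b1 b_even hT]] : exists b : F, [/\ b = 1 \/ b = -1,
    (~~ odd (p + q) -> b = 1) &
    (odd (p + q) -> full_prod h = b *: full_prod gen)].
  have [on|] := boolP (odd (p + q)); last by exists 1; split=> //; left.
  have [hE|hE] := full_prod_sign hrel on (hTr on).
    by exists 1; split=> [|//|_]; [left|rewrite full_prod_gen scale1r].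
  exists (-1); split=> [|//|_]; first by right.
  by rewrite full_prod_gen scaleN1r.
have bb : b * b = 1 by case: b1 => ->; rewrite ?mulrNN mulr1.
(* The rescaled system has the same central products as the generators: for odd n the total factor
   is b^(n+1) = 1. *)
pose g a := b *: h a.
have grel : cliff_rel g.
  move=> a c; rewrite /g -!scalerAl -!scalerAr !scalerA bb !scale1r.
  exact: hrel.
have gcentral A : central_ix F A -> bprod g A = basis_cl F A.
  move=> /(central_ixP two)[->|[on ->]]; first by rewrite bprod0.
  rewrite bprodZ -full_prodE hT // cardsT card_ord scalerA full_prod_gen.
  rewrite -exprSr -[(p + q).+1]odd_double_half /= on /= add0n -muln2 mulnC exprM.
  by rewrite expr2 bb expr1n scale1r.
have [K Ku KE] := intertwiner_exists two grel gcentral.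
exists b, K; split=> // a.
by rewrite -scalerAr -KE /g -scalerAl scalerA bb scale1r.
Qed.

(** h^A is conjugate to e^A by K up to a sign, which enters twice. The conjugation then disappears,
    since [avg] is central and invariant under cyclic permutation. *)
Lemma intw_self h X : cliff_rel h ->
  (odd (p + q) -> Tr_cl (full_prod h) = 0) -> intw h h X = avg X.
Proof.
move=> hrel hTr; have [b [K [b1 _ Ku KE _]]] := pauli_theorem hrel hTr.
have bb : b ^+ 2 = 1 by case: b1 => ->; rewrite ?sqrrN expr1n.
have hE A : bprod h A = b ^+ #|A| *: (K * basis_cl F A * K^-1).
  rewrite -[LHS](mulrK Ku) (bprod_intertwine A KE) bprodZ bprod_gen.
  by rewrite -scalerAr -scalerAl.
have -> : intw h h X = K * avg (K^-1 * X * K) * K^-1.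
  rewrite /avg /intw mulr_sumr mulr_suml; apply: eq_bigr => B _.
  rewrite hE bprod_gen -[in RHS]scalerAr -[in LHS]scalerAr -!scalerAl; congr (_ *: _).
  by rewrite scalerA -expr2 -exprM mulnC exprM bb expr1n scale1r !mulrA.
by rewrite -avg_com // mulrK // avg_mulC mulVKr.
Qed.

End PauliTheorem.

Import Order.TTheory Num.Theory.
Import numFieldNormedType.Exports.
Local Open Scope classical_set_scope.
Local Open Scope ring_scope.

(** * Linear differential equations *)

Section RealLine.
Variable R : realType.
Implicit Types (f g G : R -> R) (s t : R).

Lemma is_derive_cont f d t : is_derive t 1 f d -> {for t, continuous f}.
Proof. by case=> df _; apply/differentiable_continuous/derivable1_diffP. Qed.

Lemma is_derive_opp f d t :
  is_derive (- t) 1 f d -> is_derive t 1 (fun x => f (- x)) (- d).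
Proof.
move=> fd; rewrite -mulrN1; apply: (is_derive1_comp fd).
Qed.

Lemma mean_value f f' a b : (forall t, is_derive t 1 f (f' t)) ->
  exists2 c, `|c - a| <= `|b - a| & f b - f a = f' c * (b - a).
Proof.
move=> df.
have fc : forall t, {for t, continuous f} by move=> t; exact: is_derive_cont (df t).
have [ab|ba|->] := ltgtP a b.
- have [c /andP[]] := MVT ab (fun x _ => df x) (continuous_subspaceT fc).
  rewrite !bnd_simp => ac cb ->; exists c => //.
  by rewrite !ger0_norm; lra.
- have [c /andP[]] := MVT ba (fun x _ => df x) (continuous_subspaceT fc).
  rewrite !bnd_simp => ac cb E; exists c; last by rewrite -opprB E -mulrN opprB.
  by rewrite !ler0_norm; lra.
- by exists b; rewrite !subrr ?mulr0.
Qed.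

Lemma derive_ge0_le f f' T : 0 <= T ->
  (forall t, 0 <= t <= T -> is_derive t 1 f (f' t)) ->
  (forall t, 0 <= t <= T -> 0 <= f' t) -> f 0 <= f T.
Proof.
rewrite le_eqVlt => /predU1P[<- //|T0] df f0.
have [x x0||c cI E] := @MVT R f f' 0 T T0.
- by apply: df; move: x0; rewrite in_itv /= => /andP[/ltW -> /ltW ->].
- apply: continuous_in_subspaceT => x; rewrite inE /= in_itv /= => xI.
  exact: is_derive_cont (df _ xI).
- rewrite -subr_ge0 E subr0; apply: mulr_ge0; last exact: ltW.
  by apply: f0; move: cI; rewrite in_itv /= => /andP[/ltW -> /ltW ->].
Qed.

Local Notation mu := (@lebesgue_measure R).

Lemma primitive_exists g : continuous g ->
  exists G, G 0 = 0 /\ forall t, is_derive t 1 G (g t).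
Proof.
move=> gc.
(* The lower limit - M gives a primitive on |x| < M only. By [HE], H M x - H M 0 does not depend on
   M, so these primitives glue on the whole line. *)
pose H M x := (\int[mu]_(t in `[- M, x]) g t)%R.
have HP (M x : R) : `|x| < M -> is_derive x 1 (H M) (g x).
  rewrite ltr_norml => /andP[Mx xM].
  have gi : mu.-integrable `[- M, M] (EFin \o g).
    apply: continuous_compact_integrable; first exact: segment_compact.
    exact: continuous_subspaceT.
  have := @continuous_FTC1_closed R g (- M) x M xM gi Mx (gc x).
  by move=> [d <-]; rewrite derive1E; apply: derivableP.
have HE (M N x : R) : `|x| < M -> M <= N -> H M x - H M 0 = H N x - H N 0.
  move=> xM MN; have M0 : 0 < M by apply: le_lt_trans xM.
  have dD (y : R) : `|y| < M -> is_derive y 1 (H M \- H N) 0.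
    move=> yM; rewrite -(subrr (g y)); apply: is_deriveB; apply: HP => //.
    exact: lt_le_trans MN.
  suff E : (H M \- H N) x = (H M \- H N) 0.
    by move: E => /=; lra.
  have dI (a b : R) : `|a| < M -> `|b| < M -> a < b -> (H M \- H N) a = (H M \- H N) b.
    rewrite !ltr_norml => /andP[aM Ma] /andP[bM Mb] ab.
    have dI' (y : R) : a <= y <= b -> is_derive y 1 (H M \- H N) 0.
      by move=> /andP[ay yb]; apply: dD; rewrite ltr_norml; apply/andP; split; lra.
    have [y||c _ E] := @MVT R (H M \- H N) (fun=> 0) a b ab.
    - by rewrite in_itv /= => /andP[ay yb]; apply: dI'; rewrite !ltW.
    - apply: continuous_in_subspaceT => y; rewrite inE /= in_itv /= => yI.
      exact: is_derive_cont (dI' _ yI).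
    - by apply/esym/eqP; rewrite -subr_eq0 E mul0r.
  by case: (ltgtP x 0) => [x0|x0|->//]; [|apply/esym]; apply: dI; rewrite ?normr0.
exists (fun x => H (`|x| + 1) x - H (`|x| + 1) 0); split; first by rewrite subrr.
move=> t; pose M := `|t| + 2.
have tM : `|t| < M by rewrite /M; lra.
apply: (@near_eq_is_derive _ _ _ (fun x => H M x - H M 0)).
  near=> x.
  have xt : `|x| + 1 <= M.
    have : `|t - x| < 1 by near: x; apply: cvgr_dist_lt; rewrite ?ltr01.
    by rewrite /M; have := ler_normB t (t - x); rewrite opprB addrCA subrr addr0; lra.
  by apply/esym; apply: HE => //; lra.
by rewrite -[g t]subr0; apply: is_deriveB; apply: HP.
Unshelve. all: by end_near. Qed.

Lemma taylor2_bound f f' f'' K t : (forall x : R, is_derive x 1 f (f' x)) ->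
  (forall x : R, is_derive x 1 f' (f'' x)) ->
  (forall x, `|x| <= `|t| -> `|f'' x| <= K) ->
  `|f t - f 0 - t * f' 0| <= K * t ^+ 2.
Proof.
move=> df df' K''.
have [c cI ->] := mean_value 0 t df; have [e eI E] := mean_value 0 c df'.
rewrite !subr0 in cI eI E *.
have -> : f' c * t - t * f' 0 = t * (f'' e * c) by rewrite -E; ring.
rewrite !normrM -(real_normK (num_real t)).
have -> : K * `|t| ^+ 2 = `|t| * (K * `|t|) by ring.
by rewrite ler_wpM2l // ler_pM // K'' // (le_trans eI).
Qed.

(** A form without division, directly accessible to error estimates and with no exception at t =
    0. *)
Lemma is_deriveP (V : normedModType R) (f : V -> R) x v d : is_derive x v f d <->
  forall e, 0 < e -> exists2 r, 0 < r &
    forall t, `|t| < r -> `|f (t *: v + x) - f x - t * d| <= e * `|t|.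
Proof.
pose q := fun h : R => h^-1 *: ((f \o shift x) (h *: v) - f x).
have qE e t : t != 0 ->
    (`|d - q t| <= e) = (`|f (t *: v + x) - f x - t * d| <= e * `|t|).
  move=> t0; rewrite -ler_pdivrMr ?normr_gt0 // -normfV -normrM distrC.
  congr (`|_| <= _); rewrite mulrBl; congr (_ - _).
    by rewrite /q /= /GRing.scale /= mulrC.
  by rewrite mulrAC mulfV // mul1r.
have qP : is_derive x v f d <-> q @ 0^' --> d.
  split=> [[df <-]|qd]; first exact: df.
  by split; [apply/cvg_ex; exists d|apply: cvg_lim].
rewrite qP; split=> [/cvgrPdist_le H e e0|H].
  have := H e e0; rewrite near_withinE => /nbhs_ballP[r /= r0 Hr].
  exists r => // t tr; have [->|t0] := eqVneq t 0.
    by rewrite scale0r add0r subrr mul0r subrr normr0 mulr0.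
  by rewrite -qE //; apply: Hr => //; rewrite /ball /= sub0r normrN.
apply/cvgrPdist_le => e /H[r r0 Hr]; rewrite near_withinE.
apply/nbhs_ballP; exists r => //= t; rewrite /ball /= sub0r normrN => tr t0.
by rewrite qE //; apply: Hr.
Qed.

Lemma is_derive_line (V : normedModType R) (f : V -> R) x v s d :
  is_derive (s *: v + x) v f d <-> is_derive s 1 (fun t => f (t *: v + x)) d.
Proof.
rewrite !is_deriveP; split=> H e /H[r r0 Hr]; exists r => // t /Hr.
  by rewrite [t *: 1]mulr1 addrA -scalerDl.
by rewrite [t *: 1]mulr1 addrA -scalerDl.
Qed.

(** The intervals of center u k and radius c / 2^k are nested; the supremum of their left ends lies
    in all of them, whence the explicit rate. *)
Lemma geometric_limit (u : nat -> R) c :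
  (forall k, `|u k.+1 - u k| <= c / 2 ^+ k.+1) ->
  exists l, forall k, `|l - u k| <= c / 2 ^+ k.
Proof.
move=> uc; pose lo k := u k - c / 2 ^+ k; pose hi k := u k + c / 2 ^+ k.
have c0 : 0 <= c.
  by have := le_trans (normr_ge0 _) (uc 0%N); rewrite pmulr_lge0 ?invr_gt0 ?exprn_gt0.
have E k : c / 2 ^+ k = 2 * (c / 2 ^+ k.+1).
  by rewrite exprS; field; rewrite expf_neq0.
have loS k : lo k <= lo k.+1.
  by have := uc k; rewrite /lo (E k) ler_norml => /andP[]; lra.
have hiS k : hi k.+1 <= hi k.
  by have := uc k; rewrite /hi (E k) ler_norml => /andP[]; lra.
have lohi k : lo k <= hi k.
  have : 0 <= c / 2 ^+ k by rewrite divr_ge0 ?exprn_ge0.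
  by rewrite /lo /hi; lra.
have mlo : {homo lo : m n / (m <= n)%N >-> m <= n} by exact/nondecreasing_seqP.
have mhi : {homo hi : m n / (m <= n)%N >-> n <= m} by exact/nonincreasing_seqP.
have lh m n : lo m <= hi n.
  apply: (le_trans (mlo _ _ (leq_maxl m n))); apply: (le_trans (lohi _)).
  exact: mhi (leq_maxr m n).
exists (sup (range lo)) => k.
have up n : ubound (range lo) (hi n) by move=> _ [m _ <-]; exact: lh.
have hs : has_sup (range lo) by split; [exists (lo 0%N); exists 0%N|exists (hi 0%N)].
have lk : lo k <= sup (range lo) by apply: ub_le_sup; [exact: hs.2|exists k].
have hk : sup (range lo) <= hi k by apply: ge_sup => //; exact: hs.1.
by rewrite ler_norml; apply/andP; move: lk hk; rewrite /lo /hi; split; lra.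
Qed.

Lemma uniform_limit_continuous (u : nat -> R -> R) (l w : R -> R) :
  (forall k, continuous (u k)) -> continuous w ->
  (forall k t, `|l t - u k t| <= w t / 2 ^+ k) -> continuous l.
Proof.
move=> uc wc su t; apply/cvgrPdist_le => e e0.
have w0 x : 0 <= w x.
  by have := le_trans (normr_ge0 _) (su 0%N x); rewrite expr0 divr1.
(* The added 1 absorbs the variation of w near t. *)
have [k kE] : exists k, (w t + 1) / 2 ^+ k <= e / 3.
  pose m := Num.bound ((w t + 1) / (e / 3)); exists m.
  rewrite ler_pdivrMr ?exprn_gt0 // mulrC -ler_pdivrMr ?divr_gt0 //.
  have h : (w t + 1) / (e / 3) < m%:R.
    by apply: archi_boundP; rewrite !divr_ge0 ?addr_ge0 ?w0 // ltW.
  apply/ltW/(lt_le_trans h); rewrite -natrX ler_nat; apply: ltnW; exact: ltn_expl.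
near=> x.
have h1 : `|u k t - u k x| <= e / 3.
  by near: x; move/cvgrPdist_le: (uc k t); apply; rewrite divr_gt0.
have h2 : `|w t - w x| <= 1.
  by near: x; move/cvgrPdist_le: (wc t); apply.
have h3 : w x / 2 ^+ k <= e / 3.
  apply: le_trans kE; rewrite ler_pM2r ?invr_gt0 ?exprn_gt0 //.
  by move: h2; rewrite ler_norml => /andP[]; lra.
have h4 : w t / 2 ^+ k <= e / 3.
  by apply: le_trans kE; rewrite ler_pM2r ?invr_gt0 ?exprn_gt0 //; lra.
have := su k t; have := su k x.
have -> : l t - l x = (l t - u k t) + (u k t - u k x) - (l x - u k x) by ring.
move=> hx ht; apply: le_trans (ler_normB _ _) _; apply: le_trans (lerD (ler_normD _ _) (lexx _)) _.
by lra.
Unshelve. all: by end_near. Qed.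

End RealLine.

Section WeightedBound.
Variable R : realType.
Implicit Types (f g G L l : R -> R) (s t : R).


Lemma is_derive_sum_seq (V : normedModType R) (J : Type) (r : seq J)
    (f : J -> V -> R) (d : J -> R) (x v : V) :
  (forall j, is_derive x v (f j) (d j)) ->
  is_derive x v (fun y => \sum_(j <- r) f j y) (\sum_(j <- r) d j).
Proof.
move=> df; elim: r => [|j r IHr].
  rewrite big_nil; have -> : (fun y => \sum_(j <- [::]) f j y) = cst 0.
    by apply/funext => y; rewrite big_nil.
  exact: is_derive_cst.
rewrite big_cons.
have -> : (fun y => \sum_(i <- j :: r) f i y) = f j + (fun y => \sum_(i <- r) f i y).
  by apply/funext => y; rewrite big_cons.
exact: is_deriveD.
Qed.


Lemma continuous_sum (T : topologicalType) (J : Type) (r : seq J) (f : J -> T -> R) :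
  (forall j, continuous (f j)) -> continuous (fun x => \sum_(j <- r) f j x).
Proof.
move=> fc; elim: r => [|j r IHr] x.
  have -> : (fun x => \sum_(j <- [::]) f j x) = cst 0.
    by apply/funext => y; rewrite big_nil.
  exact: cvg_cst.
have -> : (fun y => \sum_(i <- j :: r) f i y) = f j \+ (fun y => \sum_(i <- r) f i y).
  by apply/funext => y; rewrite big_cons.
by apply: cvgD; [exact: fc|exact: IHr].
Qed.

(** Both C e^l + G and C e^l - G are nondecreasing on [0, T] and start at C, which is
    nonnegative. *)
Lemma weighted_bound_pos G g L l C T : 0 <= C -> 0 <= T -> G 0 = 0 -> l 0 = 0 ->
  (forall t, is_derive t 1 G (g t)) -> (forall t, is_derive t 1 l (L t)) ->
  (forall t, 0 <= t <= T -> `|g t| <= C * (L t * expR (l t))) ->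
  `|G T| <= C * expR (l T).
Proof.
move=> C0 T0 G0 l0 dG dl gb.
have dE t : is_derive t 1 (fun x => C * expR (l x)) (C * (L t * expR (l t))).
  rewrite [L t * _]mulrC; apply: is_deriveZ.
rewrite ler_norml; apply/andP; split.
  have := @derive_ge0_le R (fun x => C * expR (l x) + G x)
    (fun t => C * (L t * expR (l t)) + g t) T T0.
  rewrite l0 G0 expR0 addr0 mulr1 => H.
  suff : C <= C * expR (l T) + G T by lra.
  apply: H => t tT.
  by have := gb t tT; rewrite ler_norml => /andP[]; lra.
have := @derive_ge0_le R (fun x => C * expR (l x) - G x)
  (fun t => C * (L t * expR (l t)) - g t) T T0.
rewrite l0 G0 expR0 subr0 mulr1 => H.
suff : C <= C * expR (l T) - G T by lra.
apply: H => t tT.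
by have := gb t tT; rewrite ler_norml => /andP[]; lra.
Qed.

Lemma weighted_bound G g L l C t : 0 <= C -> G 0 = 0 -> l 0 = 0 ->
  (forall t, is_derive t 1 G (g t)) -> (forall t, is_derive t 1 l (L t)) ->
  (forall t, 0 <= L t) ->
  (forall t, `|g t| <= C * (L t * expR `|l t|)) ->
  `|G t| <= C * expR `|l t|.
Proof.
move=> C0 G0 l0 dG dl L0 gb; have [t0|t0] := leP 0 t.
  have lpos T : 0 <= T -> 0 <= l T.
    by move=> T0; rewrite -l0; apply: (@derive_ge0_le R l L).
  rewrite (ger0_norm (lpos _ t0)).
  apply: (weighted_bound_pos C0 t0 G0 l0 dG dl) => x /andP[x0 _].
  by rewrite -[X in expR X](ger0_norm (lpos _ x0)).
(* Time reversal; the outer sign keeps the exponent nondecreasing. *)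
pose l' x := - l (- x).
have dl' (x : R) : is_derive x 1 l' (L (- x)).
  by rewrite -[L _]opprK; apply: is_deriveN; apply: is_derive_opp.
have l'0 : l' 0 = 0 by rewrite /l' oppr0 l0 oppr0.
have lpos T : 0 <= T -> 0 <= l' T.
  by move=> T0; rewrite -l'0; apply: (@derive_ge0_le R l' (fun x => L (- x))).
have lE T : 0 <= T -> `|l (- T)| = l' T.
  by move=> /lpos /ger0_norm <-; rewrite normrN.
have nt0 : 0 <= - t by rewrite oppr_ge0 ltW.
rewrite -[t]opprK lE //.
have := @weighted_bound_pos (fun x => G (- x)) (fun x => - g (- x))
  (fun x => L (- x)) l' C (- t) C0 nt0.
rewrite oppr0 opprK; apply=> // [x|x /andP[x0 _]]; first exact: is_derive_opp.
by rewrite normrN -lE.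
Qed.

End WeightedBound.

Section LinearODE.
Variables (R : realType) (J : finType) (a : J -> J -> R -> R).
Hypothesis a_cont : forall i j, continuous (a i j).

(** Made total by the value 0 on discontinuous functions, so that the Picard iteration can be
    defined before its terms are known to be continuous. *)
Let prim (g : R -> R) : R -> R :=
  if pselect (continuous g) is left gc then sval (cid (primitive_exists gc)) else 0.

Let primP (g : R -> R) : continuous g -> prim g 0 = 0 /\ forall t : R, is_derive t 1 (prim g) (g t).
Proof.
move=> gc; rewrite /prim; case: pselect => [gc'|//].
exact: (svalP (cid (primitive_exists gc'))).
Qed.

Let app (y : J -> R -> R) i (t : R) := \sum_j a i j t * y j t.

Let app_cont (y : J -> R -> R) i : (forall j, continuous (y j)) -> continuous (app y i).
Proof.
move=> yc; apply: continuous_sum => j t; apply: cvgM; [exact: a_cont|exact: yc].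
Qed.

Let S (t : R) : R := \sum_i \sum_j `|a i j t|.
Let S0 t : 0 <= S t.
Proof. by rewrite sumr_ge0 // => i _; rewrite sumr_ge0. Qed.

(** The factor 2 creates the contraction: applying the system costs L / 2 by [app_bound], whereas
    integration against the weight exp |l| with l' = L absorbs L. *)
Let L (t : R) : R := 2 * (1 + S t).

Let L_cont : continuous L.
Proof.
move=> t; apply: cvgM; first exact: cvg_cst.
apply: cvgD; first exact: cvg_cst.
move: t; apply: continuous_sum => i; apply: continuous_sum => j t.
by apply: cvg_norm; exact: a_cont.
Qed.

Let app_bound (y : J -> R -> R) i t c : (forall j, `|y j t| <= c) -> 0 <= c ->
  `|app y i t| <= L t / 2 * c.
Proof.
move=> yc c0; have -> : L t / 2 = 1 + S t by rewrite /L; field.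
apply: (@le_trans _ _ (S t * c)); last by rewrite ler_wpM2r // lerDr.
apply: (le_trans (ler_norm_sum _ _ _)).
apply: (@le_trans _ _ ((\sum_j `|a i j t|) * c)).
  rewrite mulr_suml; apply: ler_sum => j _; rewrite normrM.
  exact: ler_wpM2l.
rewrite ler_wpM2r // /S [leRHS](bigD1 i) //= lerDl sumr_ge0 // => k _.
by rewrite sumr_ge0.
Qed.

Theorem linear_ode (y0 : J -> R) : exists y : J -> R -> R,
  (forall i, y i 0 = y0 i) /\
  forall i (t : R), is_derive t 1 (y i) (\sum_j a i j t * y j t).
Proof.
have [l [l0 dl]] := primitive_exists L_cont.
(* Picard iterates shrink by 1/2 at each step in the norm weighted by W,
   hence no restriction to a compact time interval. *)
pose W t := expR `|l t|.
have L0 t : 0 <= L t by rewrite mulr_ge0 // addr_ge0 // S0.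
have l_cont : continuous l by move=> t; exact: is_derive_cont (dl t).
have W_cont : continuous W.
  move=> t; apply: (@continuous_comp _ _ _ (fun x => `|l x|) expR).
    by apply: cvg_norm; exact: l_cont.
  exact: continuous_expR.
have W0 t : 0 <= W t by exact: expR_ge0.
have W1 t : 1 <= W t by rewrite -expR0 ler_expR.
(* Successive corrections of the Picard iteration; the iterates are their partial sums [s]. *)
pose y := fix y k : J -> R -> R := if k is k'.+1 then fun i => prim (app (y k') i)
  else fun i => cst (y0 i).
pose N := \sum_i `|y0 i|.
have N0 : 0 <= N by rewrite sumr_ge0.
have y_cont k : forall i, continuous (y k i).
  elim: k => [|k IHk] i; first by move=> t; exact: cvg_cst.
  by move=> t; have [_ dp] := @primP _ (@app_cont _ i IHk); exact: is_derive_cont (dp t).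
have dy k i (t : R) : is_derive t 1 (y k.+1 i) (app (y k) i t).
  by have [_ dp] := @primP _ (@app_cont _ i (y_cont k)); exact: dp.
have y_bound k : forall i t, `|y k i t| <= N / 2 ^+ k * W t.
  elim: k => [|k IHk] i t.
    rewrite expr0 divr1 /= -[`|_|]mulr1 ler_pM // /N (bigD1 i) //= lerDl.
    exact: sumr_ge0.
  apply: (@weighted_bound _ _ (app (y k) i) L) => //.
  - by rewrite divr_ge0 ?exprn_ge0.
  - exact: (@primP _ (@app_cont _ i (y_cont k))).1.
  move=> x; have := @app_bound (y k) i x _ (fun j => IHk j x).
  move=> /(_ _)/le_trans; apply; first by rewrite mulr_ge0 // divr_ge0 ?exprn_ge0.
  by rewrite exprS invfM /W; lra.
pose s K i t := \sum_(k < K) y k i t.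
have s_cont K i : continuous (s K i).
  by apply: continuous_sum => k; exact: y_cont.
have lim i t : exists x, forall K, `|x - s K i t| <= (2 * N * W t) / 2 ^+ K.
  apply: geometric_limit => k; rewrite /s big_ord_recr /= addrAC subrr add0r.
  apply: (le_trans (y_bound k i t)); rewrite exprS.
  rewrite le_eqVlt; apply/orP; left; apply/eqP; field.
  by rewrite expf_neq0.
pose u i t := sval (cid (lim i t)).
have uP i t K : `|u i t - s K i t| <= (2 * N * W t) / 2 ^+ K.
  exact: (svalP (cid (lim i t))).
have u_cont i : continuous (u i).
  apply: (uniform_limit_continuous (s_cont^~ i) _ (fun K t => uP i t K)).
  by move=> t; apply: cvgM; [exact: cvg_cst|exact: W_cont].
have ds K i (t : R) : is_derive t 1 (s K.+1 i) (app (s K) i t).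
  have -> : app (s K) i t = 0 + \sum_(k < K) app (y k) i t.
    rewrite add0r /app exchange_big /=; apply: eq_bigr => j _.
    by rewrite mulr_sumr.
  have -> : s K.+1 i = cst (y0 i) + (fun x => \sum_(k < K) y k.+1 i x).
    by apply/funext => x; rewrite /s big_ord_recl.
  by apply: is_deriveD; apply: is_derive_sum_seq => k; exact: dy.
(* The limit u is only known to be continuous, while z is differentiable by construction; they
   coincide because the iterates converge to both. *)
pose z i t := y0 i + prim (app u i) t.
have dz i (t : R) : is_derive t 1 (z i) (app u i t).
  have [_ dp] := @primP _ (@app_cont _ i u_cont).
  rewrite -[app u i t]add0r.
  by have := @is_deriveD _ _ _ (cst (y0 i)) _ t 1 _ _ (is_derive_cst _ _ _) (dp t).
have zu i : z i = u i.
  apply/funext => t; apply/eqP; rewrite -subr_eq0 -normr_le0.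
  have b K : `|z i t - u i t| <= (2 * N * W t) / 2 ^+ K.
    have zs : `|z i t - s K.+1 i t| <= N / 2 ^+ K * W t.
      apply: (@weighted_bound _ (z i \- s K.+1 i) (fun t => app u i t - app (s K) i t) L) => //.
      - by rewrite divr_ge0 ?exprn_ge0.
      - rewrite /= /z; have [-> _] := @primP _ (@app_cont _ i u_cont).
        rewrite /s big_ord_recl /= big1 ?addr0 ?subrr // => k _.
        exact: (@primP _ (@app_cont _ i (y_cont k))).1.
      move=> x.
      have -> : app u i x - app (s K) i x = app (fun j => u j \- s K j) i x.
        by rewrite /app -sumrB; apply: eq_bigr => j _; rewrite -mulrBr.
      have := @app_bound (fun j => u j \- s K j) i x _ (fun j => uP j x K).
      move=> /(_ _)/le_trans; apply.
        by rewrite !mulr_ge0 // invr_ge0 exprn_ge0.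
      by rewrite /W; lra.
    have := uP i t K.+1; rewrite exprS => us.
    have -> : z i t - u i t = (z i t - s K.+1 i t) - (u i t - s K.+1 i t) by ring.
    apply: (le_trans (ler_normB _ _)); apply: (le_trans (lerD zs us)).
    rewrite le_eqVlt; apply/orP; left; apply/eqP; field.
    by rewrite expf_neq0.
  apply/ler_addgt0Pl => e e0.
  pose m := Num.bound (2 * N * W t / e).
  have h : 2 * N * W t / e < m%:R.
    by apply: archi_boundP; rewrite !mulr_ge0 // invr_ge0 ltW.
  apply: (le_trans (b m)); rewrite addr0 ler_pdivrMr ?exprn_gt0 //.
  rewrite -ler_pdivrMl // mulrC; apply/ltW/(lt_le_trans h).
  by rewrite -natrX ler_nat; apply: ltnW; exact: ltn_expl.
exists z; split=> [i|i t].
  by rewrite /z; have [-> _] := @primP _ (@app_cont _ i u_cont); rewrite addr0.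
by have := dz i t; rewrite /app; under eq_bigr do rewrite -zu.
Qed.

End LinearODE.

(** * Gronwall's inequality for linear systems *)

Section Gronwall.
Variables (R : realType) (J : finType).

(** With N the size of J, the squared norm E of a solution satisfies E' <= (2 M N + 1) (E + N
    rho^2), whence E(T) <= 2 N exp((2 M N + 1) T) rho^2. The final 1 turns this into (c - 1) rho^2
    <= (c rho)^2, without square roots. *)
Definition gronwall_cst (M T : R) : R :=
  2 * #|J|%:R * expR ((2 * M * #|J|%:R + 1) * T) + 1.

Lemma gronwall_cst_ge1 M T : 1 <= gronwall_cst M T.
Proof. by rewrite /gronwall_cst lerDr !mulr_ge0 // expR_ge0. Qed.

Lemma gronwall_pos (a : J -> J -> R -> R) (r y : J -> R -> R) (M rho T : R) :
  0 <= T -> 0 <= rho ->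
  (forall i (t : R), is_derive t 1 (y i) (\sum_j a i j t * y j t + r i t)) ->
  (forall i j t, 0 <= t <= T -> `|a i j t| <= M) ->
  (forall i t, 0 <= t <= T -> `|r i t| <= rho) ->
  (forall i, `|y i 0| <= rho) ->
  forall i, `|y i T| <= gronwall_cst M T * rho.
Proof.
move=> T0 rho0 dy aM rr y0 i0.
have M0 : 0 <= M by apply: le_trans (aM i0 i0 0 _); rewrite ?lexx.
pose N : R := #|J|%:R; have N0 : 0 <= N by rewrite ler0n.
pose K := 2 * M * N + 1.
pose E t := \sum_i y i t * y i t.
pose E' t := \sum_i ((\sum_j a i j t * y j t + r i t) * y i t +
                     y i t * (\sum_j a i j t * y j t + r i t)).
have dE (t : R) : is_derive t 1 E (E' t).
  apply: is_derive_sum_seq => i; have H := is_deriveM (dy i t) (dy i t).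
  by apply: (is_derive_eq H); rewrite /GRing.scale /= [X in X + _]mulrC.
have sq (u v : R) : 2 * `|u * v| <= u * u + v * v.
  have := sqr_ge0 (`|u| - `|v|); rewrite normrM -!expr2 -(real_normK (num_real u)) -(real_normK (num_real v)).
  by rewrite !expr2; lra.
have E0 t : 0 <= E t by rewrite sumr_ge0 // => i _; rewrite -expr2 sqr_ge0.
have E'K t : 0 <= t <= T -> E' t <= K * (E t + N * (rho * rho)).
  move=> tT.
  apply: (@le_trans _ _ (\sum_i (\sum_j M * (y i t * y i t + y j t * y j t) +
                                 (y i t * y i t + rho * rho)))).
    apply: ler_sum => i _.
    have -> : (\sum_j a i j t * y j t + r i t) * y i t + y i t * (\sum_j a i j t * y j t + r i t)
            = \sum_j 2 * (a i j t * (y i t * y j t)) + 2 * (r i t * y i t).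
      rewrite [X in X + _]mulrC -mulr2n -[LHS]mulr_natl mulrDr mulrDr mulr_sumr mulr_sumr.
      congr (_ + _); last by congr (_ * _); rewrite mulrC.
      by apply: eq_bigr => j _; congr (_ * _); rewrite mulrCA.
    apply: lerD.
      apply: ler_sum => j _; apply: (le_trans (ler_norm _)).
      rewrite !normrM normr_nat mulrCA -normrM; apply: ler_pM => //; exact: aM.
    have h1 := sq (r i t) (y i t); have h2 := ler_norm (r i t * y i t).
    have h3 : r i t * r i t <= rho * rho.
      rewrite -expr2 -(real_normK (num_real (r i t))) expr2.
      by rewrite ler_pM // rr.
    by lra.
  rewrite big_split /= big_split /= sumr_const.
  have -> : \sum_i \sum_j M * (y i t * y i t + y j t * y j t) = 2 * M * N * E t.
    transitivity (\sum_i M * (N * (y i t * y i t) + E t)).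
      apply: eq_bigr => i _; rewrite -mulr_sumr big_split /= sumr_const.
      by rewrite -[_ *+ _]mulr_natl.
    rewrite -mulr_sumr big_split /= -mulr_sumr sumr_const -[_ *+ _]mulr_natl.
    by rewrite -/(E t) -/N; ring.
  rewrite -/(E t) -[_ *+ _]mulr_natl -/N /K.
  have : 0 <= 2 * M * N * (N * (rho * rho)) by rewrite !mulr_ge0.
  by lra.
have := @derive_ge0_le R (fun t => - ((E t + N * (rho * rho)) * expR (- K * t)))
  (fun t => - (E' t * expR (- K * t) + (E t + N * (rho * rho)) * (expR (- K * t) * - K))) T T0.
move=> /(_ _ _)/[!mulr0] /[!expR0] /[!mulr1] H.
have {H} : - (E 0 + N * (rho * rho)) <= - ((E T + N * (rho * rho)) * expR (- K * T)).
  apply: H => t tT.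
    have d1 : is_derive t 1 (fun t => E t + N * (rho * rho)) (E' t).
      rewrite -[E' t]addr0.
      exact: (is_deriveD (dE t) (is_derive_cst (N * (rho * rho)) t 1)).
    have d2 : is_derive t 1 (fun t => expR (- K * t)) (expR (- K * t) * - K).
      have dK : is_derive t 1 (fun t => - K * t) (- K).
        by have := is_deriveZ (- K) (is_derive_id t 1); rewrite [_ *: 1]mulr1.
      exact: (is_derive1_comp (is_derive_expR (- K * t)) dK).
    apply: is_deriveN; have H := is_deriveM d1 d2; apply: (is_derive_eq H).
    by rewrite /GRing.scale /= addrC [X in X + _]mulrC.
  have := E'K t tT; have e0 := expR_ge0 (- K * t) => h.
  have -> : - (E' t * expR (- K * t) + (E t + N * (rho * rho)) * (expR (- K * t) * - K))
   = (K * (E t + N * (rho * rho)) - E' t) * expR (- K * t) by ring.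
  by rewrite mulr_ge0 // subr_ge0.
rewrite lerN2 => h.
have E0' : E 0 <= N * (rho * rho).
  rewrite /E /N mulr_natl -sumr_const.
  apply: ler_sum => i _; rewrite -expr2 -(real_normK (num_real _)) expr2.
  by rewrite ler_pM.
have ET : E T <= 2 * N * expR (K * T) * (rho * rho).
  have e0 := expR_gt0 (K * T).
  have ee : expR (- K * T) * expR (K * T) = 1 by rewrite -expRD mulNr addNr expR0.
  have : (E T + N * (rho * rho)) <= 2 * N * (rho * rho) * expR (K * T).
    have -> : E T + N * (rho * rho) =
        (E T + N * (rho * rho)) * expR (- K * T) * expR (K * T).
      by rewrite -mulrA ee mulr1.
    rewrite ler_pM2r //; apply: (le_trans h).
    have -> : 2 * N * (rho * rho) = N * (rho * rho) + N * (rho * rho) by ring.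
    by rewrite lerD2r.
  have : 0 <= N * (rho * rho) by rewrite !mulr_ge0.
  by lra.
have c1 := gronwall_cst_ge1 M T; rewrite -/N -/K in c1.
set c := gronwall_cst M T in c1 *.
have cE : 2 * N * expR (K * T) = c - 1 by rewrite /c /gronwall_cst -/N -/K addrK.
rewrite -ler_sqr ?nnegrE ?mulr_ge0 //; last by apply: le_trans c1.
rewrite (real_normK (num_real _)).
apply: (@le_trans _ _ (E T)).
  by rewrite /E (bigD1 i0) //= -expr2 lerDl sumr_ge0 // => i _; rewrite -expr2 sqr_ge0.
apply: (le_trans ET); rewrite cE exprMn [rho ^+ 2]expr2 ler_wpM2r ?mulr_ge0 //.
have : 0 <= c * (c - 1) by rewrite mulr_ge0 ?subr_ge0 //; apply: le_trans c1.
by rewrite expr2; lra.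
Qed.

Lemma gronwall (a : J -> J -> R -> R) (r y : J -> R -> R) (M rho T : R) :
  0 <= rho ->
  (forall i (t : R), is_derive t 1 (y i) (\sum_j a i j t * y j t + r i t)) ->
  (forall i j t, `|t| <= `|T| -> `|a i j t| <= M) ->
  (forall i t, `|t| <= `|T| -> `|r i t| <= rho) ->
  (forall i, `|y i 0| <= rho) ->
  forall i, `|y i T| <= gronwall_cst M `|T| * rho.
Proof.
move=> rho0 dy aM rr y0 i; have [T0|T0] := leP 0 T.
  have tb t : 0 <= t <= T -> `|t| <= `|T|.
    by move=> /andP[t0 tT]; rewrite !ger0_norm.
  have H := @gronwall_pos a r y M rho T T0 rho0 dy.
  rewrite [X in gronwall_cst M X]ger0_norm //; apply: H => //.
    by move=> i' j t /tb; exact: aM.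
  by move=> i' t /tb; exact: rr.
have T0' : 0 <= - T by rewrite oppr_ge0 ltW.
have tb t : 0 <= t <= - T -> `|- t| <= `|T|.
  by move=> /andP[t0 tT]; rewrite normrN (ltr0_norm T0) ger0_norm.
rewrite [X in gronwall_cst M X]ltr0_norm //.
have := @gronwall_pos (fun i j t => - a i j (- t)) (fun i t => - r i (- t))
  (fun i t => y i (- t)) M rho (- T) T0' rho0.
move=> /(_ _ _ _ _ i); rewrite opprK; apply.
- move=> i' t; have H := is_derive_opp (dy i' (- t)); apply: (is_derive_eq H).
  by rewrite opprD; congr (_ - _); rewrite -sumrN; apply: eq_bigr => j _; rewrite mulNr.
- by move=> i' j t /tb tT; rewrite normrN; exact: aM.
- by move=> i' t /tb tT; rewrite normrN; exact: rr.
- by move=> i'; rewrite oppr0.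
Qed.

End Gronwall.

(** * Symmetry of mixed derivatives *)

Section Schwarz.
Variable R : realType.

(** The second difference over a small square of side h, evaluated by mean values in either order,
    identifies a value of [phist] with a value of [phits] near the origin; continuity there closes
    the gap. *)
Lemma schwarz_plane (phi phis phit phist phits : R -> R -> R) :
  (forall s t : R, is_derive s 1 (phi^~ t) (phis s t)) ->
  (forall s t : R, is_derive t 1 (phi s) (phit s t)) ->
  (forall s t : R, is_derive t 1 (phis s) (phist s t)) ->
  (forall s t : R, is_derive s 1 (phit^~ t) (phits s t)) ->
  {for (0, 0), continuous (fun z : R * R => phist z.1 z.2)} ->
  {for (0, 0), continuous (fun z : R * R => phits z.1 z.2)} ->
  phist 0 0 = phits 0 0.
Proof.
move=> ds dt dst dts cst cts; apply/eqP; rewrite -subr_eq0 -normr_le0.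
apply/ler_addgt0Pl => e e0; rewrite addr0.
have e2 : 0 < e / 2 by rewrite divr_gt0.
have get (psi : R -> R -> R) : {for (0, 0), continuous (fun z : R * R => psi z.1 z.2)} ->
    exists2 r, 0 < r & forall s t, `|s| < r -> `|t| < r -> `|psi 0 0 - psi s t| <= e / 2.
  move=> /cvgrPdist_le /(_ _ e2) /nbhs_ballP[r /= r0 Hr]; exists r => // s t sr tr.
  by apply: (Hr (s, t)); split; rewrite /ball /= sub0r normrN.
have [r1 r10 H1] := get _ cst; have [r2 r20 H2] := get _ cts.
pose r := Num.min r1 r2; pose h := r / 2.
have r0 : 0 < r by rewrite lt_min r10.
have h0 : 0 < h by rewrite divr_gt0.
have hr : h < r by rewrite /h; lra.
have [x xh xE] := mean_value 0 h (fun s => is_deriveB (ds s h) (ds s 0)).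
have [y yh yE] := mean_value 0 h (dst x).
have [z zh zE] := mean_value 0 h (fun t => is_deriveB (dt h t) (dt 0 t)).
have [w wh wE] := mean_value 0 h (fun s => dts s z).
have E : phist x y = phits w z.
  have hh : h * h != 0 by rewrite mulf_neq0 // gt_eqF.
  apply: (mulIf hh); move: xE zE; rewrite /= !fctE.
  rewrite [phis x h - _]yE [phit h z - _]wE !subr0 -!mulrA => <- <-; ring.
rewrite !subr0 (ger0_norm (ltW h0)) in xh yh zh wh.
have b1 := H1 x y; have b2 := H2 w z; rewrite E in b1.
have lt1 u : `|u| <= h -> `|u| < r1.
  by move=> /le_lt_trans; apply; apply: (lt_le_trans hr); rewrite ge_min lexx.
have lt2 u : `|u| <= h -> `|u| < r2.
  by move=> /le_lt_trans; apply; apply: (lt_le_trans hr); rewrite ge_min lexx orbT.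
have -> : phist 0 0 - phits 0 0 = (phist 0 0 - phits w z) - (phits 0 0 - phits w z) by ring.
apply: (le_trans (ler_normB _ _)); rewrite [leRHS](splitr e) lerD //.
  by apply: b1; apply: lt1.
by apply: b2; apply: lt2.
Qed.

Lemma schwarz (V : normedModType R) (f : V -> R) u v x :
  (forall y, derivable f y u) -> (forall y, derivable f y v) ->
  (forall y, derivable ('D_u f) y v) -> (forall y, derivable ('D_v f) y u) ->
  continuous ('D_v ('D_u f)) -> continuous ('D_u ('D_v f)) ->
  'D_v ('D_u f) x = 'D_u ('D_v f) x.
Proof.
move=> du dv duv dvu cuv cvu.
pose P (s t : R) := s *: u + (t *: v + x).
have PC s t : P s t = t *: v + (s *: u + x) by rewrite /P addrCA.
have Pcont : {for (0, 0), continuous (fun z : R * R => P z.1 z.2)}.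
  apply: cvgD; first by apply: cvgZ; [exact: cvg_fst|exact: cvg_cst].
  apply: cvgD; last exact: cvg_cst.
  by apply: cvgZ; [exact: cvg_snd|exact: cvg_cst].
have P00 : P 0 0 = x by rewrite /P !scale0r !add0r.
have := @schwarz_plane (fun s t => f (P s t)) (fun s t => 'D_u f (P s t))
  (fun s t => 'D_v f (P s t)) (fun s t => 'D_v ('D_u f) (P s t))
  (fun s t => 'D_u ('D_v f) (P s t)).
rewrite !P00; apply.
- by move=> s t; exact: ((is_derive_line f (t *: v + x) u s _).1 (derivableP (du (P s t)))).
- move=> s t; have := derivableP (dv (P s t)); rewrite {1}PC => H.
  have := (is_derive_line f (s *: u + x) v t _).1 H.
  by congr (is_derive _ _ _ _); apply/funext => t'; rewrite PC.
- move=> s t; have := derivableP (duv (P s t)); rewrite {1}PC => H.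
  have := (is_derive_line ('D_u f) (s *: u + x) v t _).1 H.
  by congr (is_derive _ _ _ _); apply/funext => t'; rewrite PC.
- by move=> s t; exact: ((is_derive_line ('D_v f) (t *: v + x) u s _).1 (derivableP (dvu (P s t)))).
- exact: (@continuous_comp _ _ _ (fun z : R * R => P z.1 z.2) _ (0, 0) Pcont (cuv _)).
- exact: (@continuous_comp _ _ _ (fun z : R * R => P z.1 z.2) _ (0, 0) Pcont (cvu _)).
Qed.

End Schwarz.

(** * Calculus in the Clifford algebra *)

Section RealCoordinates.
Variables (R : realType) (s : scalars) (p q : nat).
Local Notation F := (scal R s).
Local Notation Cl := (cliff F p q).
Local Notation J := ({set 'I_(p + q)} * bool)%type.
Implicit Types (U W Z : Cl) (c : R) (j k l : J).

Definition iota_scal (c : R) : F := mk_scal s c 0.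

(* The real (b = false) and imaginary (b = true) parts of the coordinates, at
   the index (A, b). Over the reals the second family vanishes, and so do the
   corresponding elements of rbasis, which thus spans but need not be free. *)
Definition rc U (j : J) : R :=
  if j.2 then im_scal (coord_cl U j.1) else re_scal (coord_cl U j.1).

Definition rbasis (j : J) : Cl :=
  mk_scal s (~~ j.2)%:R (j.2)%:R *: basis_cl F j.1.

Lemma scal_two_neq0 : (2%:R : F) != 0.
Proof. by case: s => /=; rewrite pnatr_eq0. Qed.

Lemma re_scalD (x y : F) : re_scal (x + y) = re_scal x + re_scal y.
Proof. by case: s x y => //= - [? ?] [? ?]. Qed.

Lemma im_scalD (x y : F) : im_scal (x + y) = im_scal x + im_scal y.
Proof. by case: s x y => /= [_ _|[? ?] [? ?]] //; rewrite addr0. Qed.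

Lemma re_scalM (c : R) (x : F) : re_scal (iota_scal c * x) = c * re_scal x.
Proof. by rewrite /iota_scal; case: s x => //= - [a b] /=; rewrite mul0r subr0. Qed.

Lemma im_scalM (c : R) (x : F) : im_scal (iota_scal c * x) = c * im_scal x.
Proof.
by rewrite /iota_scal; case: s x => /= [_|[a b] /=]; rewrite ?mulr0 // mul0r addr0.
Qed.

Lemma scal_inj (x y : F) : re_scal x = re_scal y -> im_scal x = im_scal y -> x = y.
Proof. by case: s x y => //= - [a b] [a' b'] /= -> ->. Qed.

Lemma scalE (x : F) : x = iota_scal (re_scal x) * mk_scal s 1 0 +
  iota_scal (im_scal x) * mk_scal s 0 1.
Proof.
rewrite /iota_scal; case: s x => /= [x|[a b]]; first by rewrite mulr1 mulr0 addr0.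
by apply/eqP; rewrite eq_complex /=; apply/andP; split; apply/eqP; ring.
Qed.

Lemma rcD U W j : rc (U + W) j = rc U j + rc W j.
Proof. by rewrite /rc coord_clD re_scalD im_scalD; case: ifP. Qed.

Lemma rcZ c U j : rc (iota_scal c *: U) j = c * rc U j.
Proof. by rewrite /rc coord_clZ re_scalM im_scalM; case: ifP. Qed.

Lemma rc_inj U W : (forall j, rc U j = rc W j) -> U = W.
Proof.
move=> UW; apply: cliffP => A; apply: scal_inj; first exact: (UW (A, false)).
exact: (UW (A, true)).
Qed.

Lemma rc0 j : rc 0 j = 0.
Proof. by apply: (addrI (rc 0 j)); rewrite -rcD !addr0. Qed.

Lemma rcN U j : rc (- U) j = - rc U j.
Proof. by apply: (addrI (rc U j)); rewrite -rcD !subrr rc0. Qed.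

Lemma rcB U W j : rc (U - W) j = rc U j - rc W j.
Proof. by rewrite rcD rcN. Qed.

Lemma rc_sum (I : Type) (r : seq I) (P : pred I) (f : I -> Cl) j :
  rc (\sum_(i <- r | P i) f i) j = \sum_(i <- r | P i) rc (f i) j.
Proof. exact: (big_morph (rc^~ j) (fun U W => rcD U W j) (rc0 j)). Qed.

Lemma rcE U : U = \sum_j iota_scal (rc U j) *: rbasis j.
Proof.
rewrite {1}(cliffE U).
transitivity (\sum_A \sum_b iota_scal (rc U (A, b)) *: rbasis (A, b)).
  apply: eq_bigr => A _; rewrite big_bool /rbasis /rc /= !scalerA -scalerDl.
  by rewrite {1}(scalE (coord_cl U A)) addrC.
by rewrite pair_bigA; apply: eq_bigr => - [A b].
Qed.

Lemma mulr_rcr U W : U * W = \sum_j iota_scal (rc W j) *: (U * rbasis j).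
Proof.
by rewrite {1}(rcE W) mulr_sumr; apply: eq_bigr => j _; rewrite scalerAr.
Qed.

Lemma mulr_rcl U W : U * W = \sum_j iota_scal (rc U j) *: (rbasis j * W).
Proof.
by rewrite {1}(rcE U) mulr_suml; apply: eq_bigr => j _; rewrite scalerAl.
Qed.

Lemma rcM U W i :
  rc (U * W) i = \sum_j \sum_k rc U j * rc W k * rc (rbasis j * rbasis k) i.
Proof.
rewrite mulr_rcl rc_sum; apply: eq_bigr => j _.
rewrite rcZ mulr_rcr rc_sum mulr_sumr; apply: eq_bigr => k _.
by rewrite rcZ mulrA.
Qed.

Definition mul_cst : R := \sum_i \sum_j \sum_k `|rc (rbasis j * rbasis k) i|.

Lemma mul_cst_ge0 : 0 <= mul_cst.
Proof. by do 3![rewrite sumr_ge0 // => ? _]. Qed.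

Lemma rcM_bound U W (a b : R) i : 0 <= a -> 0 <= b ->
  (forall j, `|rc U j| <= a) -> (forall j, `|rc W j| <= b) ->
  `|rc (U * W) i| <= mul_cst * (a * b).
Proof.
move=> a0 b0 Ua Wb; rewrite rcM.
apply: (@le_trans _ _ (\sum_j \sum_k a * b * `|rc (rbasis j * rbasis k) i|)).
  apply: (le_trans (ler_norm_sum _ _ _)); apply: ler_sum => j _.
  apply: (le_trans (ler_norm_sum _ _ _)); apply: ler_sum => k _.
  by rewrite !normrM ler_wpM2r // ler_pM.
under eq_bigr do rewrite -mulr_sumr; rewrite -mulr_sumr mulrC.
rewrite ler_wpM2r ?mulr_ge0 // /mul_cst [leRHS](bigD1 i) //= lerDl.
by do 3![rewrite sumr_ge0 // => ? _].
Qed.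

Section Derivative.
Variable V : normedModType R.
Implicit Types (f g : V -> Cl) (x v : V) (d e : Cl).

Definition is_dcl f x v d := forall j, is_derive x v (fun y => rc (f y) j) (rc d j).

Lemma is_dcl_eq f x v d e : is_dcl f x v d -> d = e -> is_dcl f x v e.
Proof. by move=> fd <-. Qed.

Lemma is_dcl_cst U x v : is_dcl (fun=> U) x v 0.
Proof. by move=> j; rewrite rc0; exact: (is_derive_cst (rc U j) x v). Qed.

Lemma is_dclD f g x v d e : is_dcl f x v d -> is_dcl g x v e ->
  is_dcl (fun y => f y + g y) x v (d + e).
Proof.
move=> fd ge j; rewrite rcD; under eq_fun do rewrite rcD.
exact: (is_deriveD (fd j) (ge j)).
Qed.

Lemma is_dclN f x v d : is_dcl f x v d -> is_dcl (fun y => - f y) x v (- d).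
Proof.
move=> fd j; rewrite rcN; under eq_fun do rewrite rcN.
exact: (is_deriveN (fd j)).
Qed.

Lemma is_dclB f g x v d e : is_dcl f x v d -> is_dcl g x v e ->
  is_dcl (fun y => f y - g y) x v (d - e).
Proof. by move=> fd ge; apply: is_dclD => //; exact: is_dclN. Qed.

Lemma is_derive_mul (f g : V -> R) x v (df dg : R) :
  is_derive x v f df -> is_derive x v g dg ->
  is_derive x v (fun y => f y * g y) (df * g x + f x * dg).
Proof.
move=> Df Dg; apply: (is_derive_eq (is_deriveM Df Dg)).
by rewrite /GRing.scale /= addrC [X in X + _]mulrC.
Qed.

Lemma is_derive_mulr (f : V -> R) x v (df c : R) :
  is_derive x v f df -> is_derive x v (fun y => f y * c) (df * c).
Proof.
move=> Df; apply: (is_derive_eq (is_derive_mul Df (is_derive_cst c x v))).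
by rewrite mulr0 addr0.
Qed.

Lemma is_dclM f g x v d e : is_dcl f x v d -> is_dcl g x v e ->
  is_dcl (fun y => f y * g y) x v (d * g x + f x * e).
Proof.
move=> fd ge i; rewrite rcD !rcM; under eq_fun do rewrite rcM.
rewrite -big_split /=.
apply: is_derive_sum_seq => j; rewrite -big_split /=.
apply: is_derive_sum_seq => k; rewrite -mulrDl.
exact: (is_derive_mulr _ (is_derive_mul (fd j) (ge k))).
Qed.

Lemma is_dclZ (c : F) f x v d : is_dcl f x v d -> is_dcl (fun y => c *: f y) x v (c *: d).
Proof.
move=> fd; have H := is_dclM (is_dcl_cst (c *: 1) x v) fd.
move: (is_dcl_eq H (e := c *: d)); rewrite mul0r add0r -scalerAl mul1r => /(_ erefl).
by under eq_fun do rewrite -scalerAl mul1r.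
Qed.

Lemma is_dcl_line f x v (t : R) d : is_dcl f (t *: v + x) v d <->
  forall j, is_derive t 1 (fun t : R => rc (f (t *: v + x)) j) (rc d j).
Proof.
by split=> H j; [apply/(is_derive_line (fun y => rc (f y) j))|
   apply/(is_derive_line (fun y => rc (f y) j))]; exact: H.
Qed.

End Derivative.

(** A general linear [Phi t] serves both for left multiplication, in the system itself, and for
    right multiplication, in the equation of the inverse. *)
Lemma cl_ode (Phi : R -> Cl -> Cl) (Y0 : Cl) :
  (forall t, linear (Phi t)) ->
  (forall i j, continuous (fun t => rc (Phi t (rbasis j)) i)) ->
  exists Y : R -> Cl, Y 0 = Y0 /\ forall t : R, is_dcl Y t 1 (Phi t (Y t)).
Proof.
move=> Pl Pc; have [y [y0 dy]] := linear_ode Pc (rc Y0).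
(* As [rbasis] need not be free, y need not be the coordinates of [of_rc y]. It suffices that
   [of_rc] recovers each element from its coordinates, hence carries the real system to that of
   [Phi]. *)
pose of_rc (z : J -> R) : Cl := \sum_j iota_scal (z j) *: rbasis j.
have PE t z : Phi t (of_rc z) = \sum_j iota_scal (z j) *: Phi t (rbasis j).
  pose f : {linear Cl -> Cl} := HB.pack (Phi t) (GRing.isLinear.Build _ _ _ _ _ (Pl t)).
  rewrite -[Phi t]/(f : _ -> _) linear_sum.
  by apply: eq_bigr => j _; rewrite linearZ.
have rc_of z i : rc (of_rc z) i = \sum_j z j * rc (rbasis j) i.
  by rewrite rc_sum; apply: eq_bigr => j _; rewrite rcZ.
exists (fun t => of_rc (y^~ t)); split.
  by rewrite [RHS]rcE; apply: eq_bigr => j _; rewrite y0.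
move=> t i.
have -> : Phi t (of_rc (y^~ t)) =
    of_rc (fun j => \sum_k rc (Phi t (rbasis k)) j * y k t).
  apply: rc_inj => l; rewrite PE rc_sum rc_of.
  under [RHS]eq_bigr do rewrite mulr_suml; rewrite exchange_big /=.
  apply: eq_bigr => k _; rewrite rcZ {1}(rcE (Phi t (rbasis k))) rc_sum mulr_sumr.
  by apply: eq_bigr => j _; rewrite rcZ mulrA [y k t * _]mulrC.
rewrite rc_of; under eq_fun do rewrite rc_of.
apply: is_derive_sum_seq => j; exact: is_derive_mulr (dy j t).
Qed.

End RealCoordinates.

(** * Dependence of solutions on a parameter *)

Lemma rectangle_bound (R : realType) (I : finType) (psi : I -> R * R -> R) (T : R) :
  (forall i, continuous (psi i)) ->
  exists2 K, 0 <= K &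
    forall i t u, `|t| <= `|T| -> `|u| <= 1 -> `|psi i (t, u)| <= K.
Proof.
move=> pc.
have one i : exists K, 0 <= K /\
    forall t u, `|t| <= `|T| -> `|u| <= 1 -> `|psi i (t, u)| <= K.
  have cA : compact (`[- `|T|, `|T|]%classic `*` `[-1, 1]%classic : set (R * R)).
    by apply: compact_setX; exact: segment_compact.
  have cf : {within (`[- `|T|, `|T|]%classic `*` `[-1, 1]%classic : set (R * R)),
             continuous (psi i)}.
    by apply: continuous_subspaceT; exact: pc.
  have [M [_ MP]] := compact_bounded (continuous_compact cf cA).
  exists (`|M| + 1); split; first by rewrite addr_ge0.
  move=> t u tT u1; apply: (MP (`|M| + 1)).
    by rewrite (le_lt_trans (ler_norm M)) // ltrDl.
  by exists (t, u) => //; split; rewrite /= in_itv /= -ler_norml.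
pose K i := sval (cid (one i)).
have K0 i : 0 <= K i by case: (svalP (cid (one i))).
exists (\sum_i K i); first by rewrite sumr_ge0.
move=> i t u tT u1; apply: (@le_trans _ _ (K i)).
  by case: (svalP (cid (one i))) => _; exact.
by rewrite (bigD1 i) //= lerDl sumr_ge0.
Qed.

Section Transport.
Variables (R : realType) (s : scalars) (p q : nat) (V : normedModType R).
Local Notation F := (scal R s).
Local Notation Cl := (cliff F p q).
Local Notation J := ({set 'I_(p + q)} * bool)%type.

Definition continuous_cl (T : topologicalType) (f : T -> Cl) :=
  forall j : J, continuous (fun y => rc (f y) j).

Lemma continuous_clM (T : topologicalType) (f g : T -> Cl) :
  continuous_cl f -> continuous_cl g -> continuous_cl (fun y => f y * g y).
Proof.
move=> fc gc i; under eq_fun do rewrite rcM.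
apply: continuous_sum => j; apply: continuous_sum => k y.
by apply: cvgM; [apply: cvgM; [exact: fc|exact: gc]|exact: cvg_cst].
Qed.

Lemma continuous_cl_comp (T T' : topologicalType) (f : T' -> Cl) (g : T -> T') :
  continuous_cl f -> continuous g -> continuous_cl (f \o g).
Proof.
move=> fc gc j y.
exact: (@continuous_comp _ _ _ g (fun z => rc (f z) j) y (gc y) (fc j _)).
Qed.

Lemma is_dcl_continuous (f f' : R -> Cl) :
  (forall t : R, is_dcl f t 1 (f' t)) -> continuous_cl f.
Proof. by move=> df j t; exact: is_derive_cont (df t j). Qed.

(** The computation behind the error equation of [transport_param]: G + B C - C B is the derivative
    of [Cv] along u as rewritten by flatness, and it makes the first order terms cancel. *)
Lemma transport_identity (A B G C y Z : Cl) (c : F) :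
  A * Z - B * y - c *: ((G + (B * C - C * B)) * y + C * (B * y)) =
  A * (Z - y - c *: (C * y)) +
    ((A - B - c *: G) * y + c *: ((A - B) * (C * y))).
Proof.
rewrite !(mulrBr, mulrBl, mulrDl, mulrDr) -!scalerAr -!scalerAl.
rewrite !(scalerBr, scalerDr) !mulrA.
move: (A * Z) (A * y) (B * y) (c *: (G * y)) (c *: (B * C * y))
  (c *: (C * B * y)) (c *: (A * C * y)) => a1 a2 a3 a4 a5 a6 a7.
by apply: rc_inj => j; rewrite !(rcD, rcN); ring.
Qed.

(** The candidate derivative in c is known, so only its error must be shown to be o(c). Thus the
    equation in direction v spreads from the start of the lines in direction u to any time T, and
    differentiability in c is assumed at time 0 only. *)
Lemma transport_param (Cu Cv dCuv dCuvv dCvu : V -> Cl) (u v x : V)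
    (Y : R -> R -> Cl) (T : R) :
  continuous_cl Cu -> continuous_cl Cv ->
  continuous_cl dCuv -> continuous_cl dCuvv ->
  (forall y, is_dcl Cu y v (dCuv y)) -> (forall y, is_dcl dCuv y v (dCuvv y)) ->
  (forall y, is_dcl Cv y u (dCvu y)) ->
  (forall y, dCvu y - dCuv y = Cu y * Cv y - Cv y * Cu y) ->
  (forall c t : R, is_dcl (Y c) t 1 (Cu (t *: u + (c *: v + x)) * Y c t)) ->
  is_dcl (Y^~ 0) (0 : R) 1 (Cv x * Y 0 0) ->
  is_dcl (Y^~ T) (0 : R) 1 (Cv (T *: u + x) * Y 0 T).
Proof.
move=> cCu cCv cCuv cCuvv dCu ddCu dCv flat dY dY0.
pose P (t c : R) := t *: u + (c *: v + x).
have PC t c : P t c = c *: v + (t *: u + x) by rewrite /P addrCA.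
have P0 t : P t 0 = t *: u + x by rewrite /P scale0r add0r.
have Pcont : continuous (fun z : R * R => P z.1 z.2).
  move=> z; apply: cvgD; first by apply: cvgZ; [exact: cvg_fst|exact: cvg_cst].
  by apply: cvgD; [apply: cvgZ; [exact: cvg_snd|exact: cvg_cst]|exact: cvg_cst].
have fstc : continuous (fun z : R * R => z.1) by move=> z; exact: cvg_fst.
pose W t := Cv (P t 0) * Y 0 t.
have dY00 t : is_dcl (Y 0) t 1 (Cu (P t 0) * Y 0 t) by exact: dY.
have dCvP (t : R) : is_dcl (fun t => Cv (P t 0)) t 1 (dCvu (P t 0)).
  have H := dCv (P t 0); rewrite {1}P0 in H.
  move=> j; move: ((is_dcl_line _ _ _ _ _).1 H j).
  by congr (is_derive _ _ _ _); apply/funext => t'; rewrite P0.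
have dW (t : R) : is_dcl W t 1 (dCvu (P t 0) * Y 0 t + Cv (P t 0) * (Cu (P t 0) * Y 0 t)).
  exact: is_dclM (dCvP t) (dY00 t).
have [K0 K00 K0P] := @rectangle_bound R _ (fun j z => rc (Cu (P z.1 z.2)) j) T
  (continuous_cl_comp cCu Pcont).
have [K1 K10 K1P] := @rectangle_bound R _ (fun j z => rc (dCuv (P z.1 z.2)) j) T
  (continuous_cl_comp cCuv Pcont).
have [K2 K20 K2P] := @rectangle_bound R _ (fun j z => rc (dCuvv (P z.1 z.2)) j) T
  (continuous_cl_comp cCuvv Pcont).
have [KY KY0 KYP] := @rectangle_bound R _ (fun j z => rc (Y 0 z.1) j) T
  (continuous_cl_comp (is_dcl_continuous dY00) fstc).
have [KW KW0 KWP] := @rectangle_bound R _ (fun j z => rc (W z.1) j) T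
  (continuous_cl_comp (is_dcl_continuous dW) fstc).
pose Kb : R := \sum_(j : J) \sum_(l : J) `|rc (rbasis R s j) l|.
have KbP (j l : J) : `|rc (rbasis R s j) l| <= Kb.
  rewrite /Kb (bigD1 j) //= (bigD1 l) //= -addrA lerDl addr_ge0 // sumr_ge0 // => *.
  by rewrite sumr_ge0.
have Kb0 : 0 <= Kb by rewrite !sumr_ge0 // => *; rewrite sumr_ge0.
pose m := mul_cst R s p q; have m0 : 0 <= m by exact: mul_cst_ge0.
pose M := m * (K0 * Kb).
pose K3 := m * (K2 * KY + K1 * KW).
have K30 : 0 <= K3 by rewrite mulr_ge0 // addr_ge0 // mulr_ge0.
(* By flatness the error D c of the expansion to first order in c solves the
   equation of Y c up to a term E c of second order. *)
pose D c t := Y c t - Y 0 t - iota_scal s c *: W t.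
pose E c t := (Cu (P t c) - Cu (P t 0) - iota_scal s c *: dCuv (P t 0)) * Y 0 t
   + iota_scal s c *: ((Cu (P t c) - Cu (P t 0)) * W t).
have dD c (t : R) : is_dcl (D c) t 1 (Cu (P t c) * D c t + E c t).
  apply: (is_dcl_eq (is_dclB (is_dclB (dY c t) (dY00 t)) (is_dclZ (iota_scal s c) (dW t)))).
  rewrite -/(P t c) /D /E.
  have -> : dCvu (P t 0) = dCuv (P t 0) + (Cu (P t 0) * Cv (P t 0) - Cv (P t 0) * Cu (P t 0)).
    by rewrite -flat addrC subrK.
  exact: transport_identity.
have cu_line t j (c : R) : is_derive c 1 (fun c => rc (Cu (P t c)) j) (rc (dCuv (P t c)) j).
  have H := dCu (P t c); rewrite {1}PC in H.
  move: ((is_dcl_line _ _ _ _ _).1 H j).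
  by congr (is_derive _ _ _ _); apply/funext => c'; rewrite PC.
have cuv_line t j (c : R) : is_derive c 1 (fun c => rc (dCuv (P t c)) j) (rc (dCuvv (P t c)) j).
  have H := ddCu (P t c); rewrite {1}PC in H.
  move: ((is_dcl_line _ _ _ _ _).1 H j).
  by congr (is_derive _ _ _ _); apply/funext => c'; rewrite PC.
have E_bound c t j : `|t| <= `|T| -> `|c| <= 1 -> `|rc (E c t) j| <= K3 * c ^+ 2.
  move=> tT c1.
  have b1 k : `|rc (Cu (P t c) - Cu (P t 0) - iota_scal s c *: dCuv (P t 0)) k| <= K2 * c ^+ 2.
    rewrite !rcB rcZ; apply: (taylor2_bound (cu_line t k) (cuv_line t k)) => c' c'c.
    by apply: (K2P k t c') => //; apply: le_trans c1.
  have b2 k : `|rc (Cu (P t c) - Cu (P t 0)) k| <= K1 * `|c|.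
    rewrite rcB; have [c' c'c ->] := mean_value 0 c (cu_line t k).
    rewrite !subr0 in c'c *; rewrite normrM ler_wpM2r //.
    by apply: (K1P k t c') => //; apply: le_trans c1.
  have b3 k : `|rc (Y 0 t) k| <= KY by apply: (KYP k t 0); rewrite ?normr0.
  have b4 k : `|rc (W t) k| <= KW by apply: (KWP k t 0); rewrite ?normr0.
  rewrite /E rcD rcZ; apply: (le_trans (ler_normD _ _)); rewrite normrM.
  have B1 := rcM_bound j (mulr_ge0 K20 (sqr_ge0 c)) KY0 b1 b3.
  have B2 := rcM_bound j (mulr_ge0 K10 (normr_ge0 c)) KW0 b2 b4.
  apply: (le_trans (lerD B1 (ler_wpM2l (normr_ge0 c) B2))).
  rewrite -/m -(real_normK (num_real c)) /K3 le_eqVlt; apply/orP; left; apply/eqP.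
  by ring.
have a_bound c t (i j : J) : `|t| <= `|T| -> `|c| <= 1 ->
    `|rc (Cu (P t c) * rbasis R s j) i| <= M.
  by move=> tT c1; apply: rcM_bound => // k; apply: (K0P k t c).
pose cst := gronwall_cst J M `|T|.
have cst1 : 1 <= cst by exact: gronwall_cst_ge1.
have cst0 : 0 < cst by apply: lt_le_trans cst1.
move=> i; apply/is_deriveP => e e0.
pose e' := e / (2 * cst); have e'0 : 0 < e' by rewrite divr_gt0 // mulr_gt0.
have rj (j : J) : exists r, 0 < r /\ forall c, `|c| < r -> `|rc (D c 0) j| <= e' * `|c|.
  have [r r0 rP] := (is_deriveP _ _ _ _).1 (dY0 j) e' e'0.
  exists r; split=> // c /rP; rewrite [c *: 1]mulr1 addr0 /D /W P0 scale0r add0r.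
  by rewrite !rcB rcZ.
pose r j := sval (cid (rj j)).
have r0 j : 0 < r j by case: (svalP (cid (rj j))).
have rP j c : `|c| < r j -> `|rc (D c 0) j| <= e' * `|c|.
  by case: (svalP (cid (rj j))) => _; exact.
(* The inverse of a sum serves as a minimum of radii: 1 / B is at most 1, each r j, and e' / (K3 +
   1). *)
pose B := 1 + (\sum_j (r j)^-1 + (K3 + 1) / e').
have Sr0 : 0 <= \sum_j (r j)^-1 by rewrite sumr_ge0 // => j _; rewrite invr_ge0 ltW.
have Ke0 : 0 < (K3 + 1) / e' by rewrite divr_gt0 // ltr_pwDr.
have B1 : 1 <= B by rewrite /B; lra.
have B0 : 0 < B by apply: lt_le_trans B1.
exists B^-1; rewrite ?invr_gt0 // => c cB; rewrite [c *: 1]mulr1 addr0.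
have small (b : R) : 0 < b -> b <= B -> `|c| < b^-1.
  by move=> b0 bB; apply: (lt_le_trans cB); rewrite lef_pV2 ?posrE.
have c1 : `|c| <= 1 by rewrite ltW // -invr1 small.
have cr j : `|c| < r j.
  rewrite -[r j]invrK; apply: small; first by rewrite invr_gt0.
  have : (r j)^-1 <= \sum_j (r j)^-1.
    by rewrite (bigD1 j) //= lerDl sumr_ge0 // => k _; rewrite invr_ge0 ltW.
  by rewrite /B; lra.
have cK : (K3 + 1) * `|c| <= e'.
  have : `|c| < ((K3 + 1) / e')^-1 by apply: small => //; rewrite /B; lra.
  rewrite invf_div => /ltW; rewrite ler_pdivlMr ?ltr_pwDr // mulrC.
  by [].
(* A common bound for the initial error and for the source [E c]; Gronwall then gives cst * rho = e
   / 2 * |c|. *)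
pose rho := e' * `|c|.
have rho0 : 0 <= rho by rewrite mulr_ge0 // ltW.
have := @gronwall R J (fun i j t => rc (Cu (P t c) * rbasis R s j) i)
  (fun i t => rc (E c t) i) (fun i t => rc (D c t) i) M rho T rho0.
move=> /(_ _ _ _ _ i) H.
have : `|rc (D c T) i| <= cst * rho.
  apply: H => [j t|j k t tT|j t tT|j].
  - have := dD c t j; rewrite rcD mulr_rcr rc_sum.
    by under eq_bigr do rewrite rcZ mulrC.
  - exact: a_bound.
  - apply: (le_trans (E_bound c t j tT c1)).
    rewrite /rho -(real_normK (num_real c)) expr2 mulrA ler_wpM2r //.
    by apply: le_trans cK; rewrite ler_wpM2r // lerDl.
  - exact: rP.
rewrite /D !rcB rcZ /W P0 => /le_trans; apply.
have -> : cst * rho = e / 2 * `|c| by rewrite /rho /e'; field; rewrite gt_eqF.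
by rewrite ler_wpM2r //; lra.
Qed.

End Transport.

(** * Stability properties of smooth functions *)

Section Smoothness.
Variables (R : realType) (r : nat).
Local Notation V := 'rV[R]_r.
Implicit Types f g : V -> R.

Lemma CkW k f : Ck k.+1 f -> Ck k f.
Proof.
elim: k f => [|k IHk] f [fc H]; first by split.
by split=> // mu; have [df Df] := H mu; split=> //; exact: IHk.
Qed.

Lemma Ck_continuous k f : Ck k f -> continuous f.
Proof. by case: k => [|k] []. Qed.

Lemma Ck_cst k (c : R) : Ck k (fun _ : V => c).
Proof.
elim: k c => [|k IHk] c; first by split=> //; exact: cst_continuous.
split=> [|mu]; first exact: cst_continuous.
split=> [x|]; first exact: derivable_cst.
have -> : (fun x => 'D_(evec R mu) (fun _ : V => c) x) = (fun _ => 0).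
  by apply/funext => x; exact: derive_cst.
exact: IHk.
Qed.

Lemma CkD k f g : Ck k f -> Ck k g -> Ck k (fun x => f x + g x).
Proof.
elim: k f g => [|k IHk] f g fk gk;
  have cf : continuous f := @Ck_continuous _ _ fk;
  have cg : continuous g := @Ck_continuous _ _ gk.
  by split=> //; move=> x; exact: (cvgD (cf x) (cg x)).
split=> [x|mu].
  by exact: (cvgD (cf x) (cg x)).
have [df Df] := fk.2 mu; have [dg Dg] := gk.2 mu.
split=> [x|]; first exact: derivableD.
have -> : (fun x => 'D_(evec R mu) (fun x => f x + g x) x) =
    (fun x => 'D_(evec R mu) f x + 'D_(evec R mu) g x).
  by apply/funext => x; exact: deriveD.
exact: IHk.
Qed.

Lemma CkM k f g : Ck k f -> Ck k g -> Ck k (fun x => f x * g x).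
Proof.
elim: k f g => [|k IHk] f g fk gk;
  have cf : continuous f := @Ck_continuous _ _ fk;
  have cg : continuous g := @Ck_continuous _ _ gk.
  by split=> //; move=> x; exact: (cvgM (cf x) (cg x)).
split=> [x|mu].
  by exact: (cvgM (cf x) (cg x)).
have [df Df] := fk.2 mu; have [dg Dg] := gk.2 mu.
split=> [x|]; first exact: derivableM.
have -> : (fun x => 'D_(evec R mu) (fun x => f x * g x) x) =
    (fun x => f x * 'D_(evec R mu) g x + g x * 'D_(evec R mu) f x).
  by apply/funext => x; exact: deriveM.
by apply: CkD; apply: IHk => //; exact: CkW.
Qed.

Lemma Ck_sum k (J : Type) (l : seq J) (f : J -> V -> R) :
  (forall j, Ck k (f j)) -> Ck k (fun x => \sum_(j <- l) f j x).
Proof.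
move=> fk; elim: l => [|j l IHl].
  by under eq_fun do rewrite big_nil; exact: Ck_cst.
by under eq_fun do rewrite big_cons; exact: CkD.
Qed.

Lemma smooth_partial f mu : smooth f -> smooth ('D_(evec R mu) f).
Proof. by move=> fs k; exact: ((fs k.+1).2 mu).2. Qed.

Lemma smooth_derivable f mu x : smooth f -> derivable f x (evec R mu).
Proof. by move=> fs; exact: ((fs 1%N).2 mu).1. Qed.

Lemma smooth_continuous f : smooth f -> continuous f.
Proof. by move=> fs; exact: (@Ck_continuous _ _ (fs 0%N)). Qed.

Lemma smooth_schwarz f mu nu x : smooth f ->
  'D_(evec R nu) ('D_(evec R mu) f) x = 'D_(evec R mu) ('D_(evec R nu) f) x.
Proof.
move=> fs.
by apply: schwarz => [y|y|y|y||]; do ?[apply: smooth_derivable|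
  apply: smooth_continuous|apply: smooth_partial].
Qed.

End Smoothness.

Section CliffordSmoothness.
Variables (R : realType) (s : scalars) (p q r : nat).
Local Notation F := (scal R s).
Local Notation Cl := (cliff F p q).
Local Notation V := 'rV[R]_r.
Implicit Types f g : V -> Cl.

Lemma smooth_clP f : smooth_cl f <-> forall j, smooth (fun x => rc (f x) j).
Proof.
split=> [fs [A []]|fs A]; [exact: (fs A).2|exact: (fs A).1|].
by split; [exact: (fs (A, false))|exact: (fs (A, true))].
Qed.

Lemma smooth_cl_cst U : smooth_cl (fun _ : V => U : Cl).
Proof. by apply/smooth_clP => j k; exact: Ck_cst. Qed.

Lemma smooth_clM f g : smooth_cl f -> smooth_cl g -> smooth_cl (fun x => f x * g x).
Proof.
move=> /smooth_clP fs /smooth_clP gs; apply/smooth_clP => i k.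
under eq_fun do rewrite rcM.
apply: Ck_sum => j; apply: Ck_sum => l.
by apply: CkM; [apply: CkM; [exact: fs|exact: gs]|exact: Ck_cst].
Qed.

Lemma smooth_cl_sum (I : Type) (l : seq I) (f : I -> V -> Cl) :
  (forall i, smooth_cl (f i)) -> smooth_cl (fun x => \sum_(i <- l) f i x).
Proof.
move=> fs; apply/smooth_clP => j k; under eq_fun do rewrite rc_sum.
by apply: Ck_sum => i; exact: ((smooth_clP _).1 (fs i) j k).
Qed.

Lemma smooth_clZ (c : F) f : smooth_cl f -> smooth_cl (fun x => c *: f x).
Proof.
move=> fs; have := smooth_clM (smooth_cl_cst (c *: 1)) fs.
by under eq_fun do rewrite -scalerAl mul1r.
Qed.

Lemma rc_partial mu f x j :
  rc (partial_cl mu f x) j = 'D_(evec R mu) (fun y => rc (f y) j) x.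
Proof.
case: j => A b; rewrite /rc /coord_cl ffunE /re_coord /im_coord /coord_cl /=.
by move: f; case: s => f; case: b => //=; rewrite derive_cst.
Qed.

Lemma smooth_cl_partial mu f : smooth_cl f -> smooth_cl (partial_cl mu f).
Proof.
move=> /smooth_clP fs; apply/smooth_clP => j.
by under eq_fun do rewrite rc_partial; exact: smooth_partial.
Qed.

Lemma smooth_is_dcl mu f x :
  smooth_cl f -> is_dcl f x (evec R mu) (partial_cl mu f x).
Proof.
move=> /smooth_clP fs j; rewrite rc_partial; apply: derivableP.
exact: smooth_derivable.
Qed.

Lemma is_dcl_partial mu f x d :
  is_dcl f x (evec R mu) d -> derivable_cl mu f x /\ partial_cl mu f x = d.
Proof.
move=> fd; split.
  by move=> A; split; [exact: (ex_derive (is_derive := fd (A, false)))|exact: (ex_derive (is_derive := fd (A, true)))].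
by apply: rc_inj => j; rewrite rc_partial; case: (fd j).
Qed.

Lemma smooth_cl_continuous f : smooth_cl f -> continuous_cl f.
Proof. by move=> /smooth_clP fs j; exact: smooth_continuous. Qed.

Lemma smooth_cl_schwarz mu nu f : smooth_cl f ->
  partial_cl nu (partial_cl mu f) = partial_cl mu (partial_cl nu f).
Proof.
move=> /smooth_clP fs; apply/funext => x; apply: rc_inj => j.
have E (l : 'I_r) : (fun y => rc (partial_cl l f y) j) = 'D_(evec R l) (fun y => rc (f y) j).
  by apply/funext => y; rewrite rc_partial.
have E2 (k l : 'I_r) : rc (partial_cl k (partial_cl l f) x) j =
    'D_(evec R k) ('D_(evec R l) (fun y => rc (f y) j)) x.
  by rewrite -(E l); exact: rc_partial.
apply: (etrans (E2 nu mu)); apply: (etrans _ (esym (E2 mu nu))).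
exact: (smooth_schwarz mu nu x (fs j)).
Qed.

Lemma is_dcl0_cst (f : R -> Cl) : (forall t : R, is_dcl f t 1 0) ->
  forall t, f t = f 0.
Proof.
move=> df t; apply: rc_inj => j; apply/eqP; rewrite -subr_eq0.
have [c _ ->] := mean_value 0 t (fun t => df t j).
by rewrite rc0 mul0r.
Qed.

(** A solution of the adjoint equation W' = - W A provides the inverse of Y: the products W Y and W
    H Y have derivative zero, so they keep their initial values 1 and G. *)
Lemma ode_intertwine (A H Y : R -> Cl) (G : Cl) :
  continuous_cl A ->
  (forall t : R, is_dcl Y t 1 (A t * Y t)) ->
  (forall t : R, is_dcl H t 1 (A t * H t - H t * A t)) ->
  Y 0 \is a GRing.unit -> H 0 * Y 0 = Y 0 * G ->
  forall t, Y t \is a GRing.unit /\ H t * Y t = Y t * G.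
Proof.
move=> Ac dY dH Y0 H0 t.
have lin (t' : R) : linear (fun X => - (X * A t')).
  by move=> c U X; rewrite mulrDl -scalerAl opprD scalerN.
have cont i j : continuous (fun t => rc (- (rbasis R s j * A t)) i).
  have -> : (fun t => rc (- (rbasis R s j * A t)) i) =
      (fun t => - rc ((fun=> rbasis R s j) t * A t) i).
    by apply/funext => t'; rewrite rcN.
  have cM : continuous_cl (fun t => (fun=> rbasis R s j) t * A t).
    by apply: continuous_clM => // k; exact: cst_continuous.
  by move=> t'; apply: cvgN; exact: cM.
have [W [W0 dW]] := @cl_ode R s p q (fun t X => - (X * A t)) (Y 0)^-1 lin cont.
have WY (t' : R) : W t' * Y t' = 1.
  rewrite -(mulVr Y0) -W0; apply: (@is_dcl0_cst (fun t => W t * Y t)) => {}t'.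
  apply: (is_dcl_eq (is_dclM (dW t') (dY t'))).
  by rewrite mulNr mulrA addNr.
have WHY : W t * (H t * Y t) = G.
  have -> : G = W 0 * (H 0 * Y 0) by rewrite H0 mulrA WY mul1r.
  apply: (@is_dcl0_cst (fun t => W t * (H t * Y t))) => t'.
  apply: (is_dcl_eq (is_dclM (dW t') (is_dclM (dH t') (dY t')))).
  have -> : (A t' * H t' - H t' * A t') * Y t' + H t' * (A t' * Y t') =
      A t' * (H t' * Y t') by rewrite mulrBl !mulrA subrK.
  by rewrite mulNr !mulrA addNr.
have Yt : Y t \is a GRing.unit by exact: left_inverse_unit (WY t).
split=> //; rewrite -WHY mulrA.
suff -> : Y t * W t = 1 by rewrite mul1r.
by rewrite -[W t]mulr1 -(mulrV Yt) (mulrA (W t)) WY mul1r mulrV.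
Qed.

End CliffordSmoothness.

(** * Integration of the flat connection *)

Section Frobenius.
Variables (R : realType) (s : scalars) (p q r : nat).
Local Notation F := (scal R s).
Local Notation Cl := (cliff F p q).
Local Notation V := 'rV[R]_r.
Variables (C : 'I_r -> V -> Cl).
Hypothesis C_smooth : forall mu, smooth_cl (C mu).
Hypothesis C_flat : forall mu nu x,
  partial_cl mu (C nu) x - partial_cl nu (C mu) x = comm_cl (C mu x) (C nu x).

Let zero_lt (k : nat) (x : V) : V := \row_i (if (i < k)%N then 0 else x 0 i).
Let zero_at (u : 'I_r) (x : V) : V := x - x 0 u *: evec R u.

Let zero_at_coord u x : zero_at u x 0 u = 0.
Proof. by rewrite /zero_at /evec !mxE !eqxx mulr1 subrr. Qed.

Let line_coord (i j : 'I_r) t (w : V) :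
  (t *: evec R i + w) 0 j = t * (j == i)%:R + w 0 j.
Proof. by rewrite !mxE eqxx. Qed.

(** Induction on the number of coordinates treated. No regularity is asked of S in the remaining
    directions, as every line is integrated separately. Intertwining with the base point
    [zero_lt k x] is carried along, since it too propagates line by line. *)
Theorem frobenius (I : Type) (h : I -> V -> Cl) (k : nat) :
  (forall a mu x, is_dcl (h a) x (evec R mu) (comm_cl (C mu x) (h a x))) ->
  (k <= r)%N ->
  exists S : V -> Cl, forall x,
    [/\ S x \is a GRing.unit,
        forall j : 'I_r, (j < k)%N -> is_dcl S x (evec R j) (C j x * S x) &
        forall a, h a x * S x = S x * h a (zero_lt k x)].
Proof.
move=> dh; elim: k => [_|k IHk kr].
  exists (fun=> 1) => x; split=> [|//|a]; first exact: unitr1.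
  rewrite mulr1 mul1r; congr (h a _); apply/rowP => i; by rewrite mxE.
have [S SP] := IHk (ltnW kr).
pose u := Ordinal kr.
have line_cont (y : V) : continuous (fun t : R => t *: evec R u + y).
  move=> t; apply: cvgD; last exact: cvg_cst.
  by apply: cvgZ; [exact: cvg_id|exact: cvg_cst].
have Cc mu : continuous_cl (C mu) by exact: smooth_cl_continuous.
have Acont y : continuous_cl (fun t : R => C u (t *: evec R u + y)).
  exact: continuous_cl_comp (Cc u) (line_cont y).
have exY y : exists Y : R -> Cl, Y 0 = S y /\
    forall t : R, is_dcl Y t 1 (C u (t *: evec R u + y) * Y t).
  apply: (@cl_ode R s p q (fun t X => C u (t *: evec R u + y) * X)) => [t c U X|i j].
    by rewrite mulrDr -scalerAr.
  have cM : continuous_cl (fun t : R => C u (t *: evec R u + y) * (fun=> rbasis R s j) t).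
    by apply: continuous_clM => // l; exact: cst_continuous.
  exact: cM.
pose Y y := sval (cid (exY y)).
have Y0 y : Y y 0 = S y by case: (svalP (cid (exY y))).
have dY y (t : R) : is_dcl (Y y) t 1 (C u (t *: evec R u + y) * Y y t).
  by case: (svalP (cid (exY y))) => _; exact.
have zE (x : V) : x 0 u *: evec R u + zero_at u x = x by rewrite /zero_at addrC subrK.
have zline t (x : V) : zero_at u (t *: evec R u + zero_at u x) = zero_at u x.
  rewrite {1}/zero_at line_coord eqxx zero_at_coord mulr1 addr0.
  by rewrite addrC addrA addNr add0r.
have cline t (x : V) : (t *: evec R u + zero_at u x) 0 u = t.
  by rewrite line_coord eqxx zero_at_coord mulr1 addr0.
(* The previous S is kept on the hyperplane where the coordinate u vanishes and is continued along
   the lines in direction u. *)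
exists (fun x : V => Y (zero_at u x) (x 0 u)) => x.
pose y := zero_at u x.
have [Su dS hS] := SP y.
have core (H : R -> Cl) G :
    (forall t : R, is_dcl H t 1 (C u (t *: evec R u + y) * H t - H t * C u (t *: evec R u + y))) ->
    H 0 * S y = S y * G ->
    Y y (x 0 u) \is a GRing.unit /\ H (x 0 u) * Y y (x 0 u) = Y y (x 0 u) * G.
  move=> dH HG; apply: (ode_intertwine (Acont y) (dY y) dH); first by rewrite Y0.
  by rewrite Y0.
split.
(* With H = 0 and G = 0, only the invertibility in [core] remains. *)
- have [t||] // := core (fun=> 0) 0; last by rewrite mul0r mulr0.
  by rewrite mulr0 mul0r subrr; exact: is_dcl_cst.
- move=> j; rewrite ltnS leq_eqVlt => /predU1P[ju|jk].
    have -> : j = u by apply: val_inj.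
    have H := (is_dcl_line (fun x : V => Y (zero_at u x) (x 0 u)) y (evec R u)
      (x 0 u) (C u x * Y y (x 0 u))).2.
    rewrite zE in H; apply: H => i.
    have := dY y (x 0 u) i; rewrite zE.
    by congr (is_derive _ _ _ _); apply/funext => t; rewrite zline cline.
  have uj : (u == j) = false by apply/negP => /eqP uj; rewrite -uj ltnn in jk.
  have cj c : (c *: evec R j + x) 0 u = x 0 u.
    by rewrite line_coord uj mulr0 add0r.
  have zj c : zero_at u (c *: evec R j + x) = c *: evec R j + y.
    by rewrite {1}/zero_at cj /y /zero_at addrA.
  (* At time 0 the lines start from the previous S, for which direction j is already treated. *)
  have dS0 : is_dcl (fun c : R => Y (c *: evec R j + y) 0) (0 : R) 1
      (C j y * Y (0 *: evec R j + y) 0).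
    have L := (is_dcl_line S y (evec R j) 0 (C j y * S y)).1.
    rewrite scale0r add0r in L; rewrite scale0r add0r Y0 => i.
    have := L (dS j jk) i.
    by congr (is_derive _ _ _ _); apply/funext => t; rewrite Y0.
  have TT := @transport_param R s p q V (C u) (C j) (partial_cl j (C u))
    (partial_cl j (partial_cl j (C u))) (partial_cl u (C j)) (evec R u) (evec R j)
    y (fun c t => Y (c *: evec R j + y) t) (x 0 u) (Cc u) (Cc j)
    (smooth_cl_continuous (smooth_cl_partial j (C_smooth u)))
    (smooth_cl_continuous (smooth_cl_partial j (smooth_cl_partial j (C_smooth u))))
    (fun z => smooth_is_dcl j z (C_smooth u))
    (fun z => smooth_is_dcl j z (smooth_cl_partial j (C_smooth u)))
    (fun z => smooth_is_dcl u z (C_smooth j))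
    (C_flat u j) (fun c t => dY _ t) dS0.
  move: TT; rewrite zE scale0r add0r => TT.
  have H := (is_dcl_line (fun x : V => Y (zero_at u x) (x 0 u)) x (evec R j)
      0 (C j x * Y y (x 0 u))).2.
  rewrite scale0r add0r in H; apply: H => i.
  by have := TT i; congr (is_derive _ _ _ _); apply/funext => t; rewrite zj cj.
- move=> a.
  have [t||_] := core (fun t => h a (t *: evec R u + y)) (h a (zero_lt k y)).
  + exact: ((is_dcl_line _ _ _ _ _).1 (dh a u _)).
  + by rewrite scale0r add0r hS.
  rewrite zE => ->; congr (_ * h a _); apply/rowP => i.
  rewrite !mxE /= ltnS (leq_eqVlt i k); have [ik|ik|ik] := ltngtP i k => //=.
    have iu : (i == u) = false by apply/negP => /eqP iu; rewrite iu ltnn in ik.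
    by rewrite iu ?andbF mulr0 subr0.
  have -> : i = u by apply: val_inj.
  by rewrite ?eqxx mulr1 subrr.
Qed.

End Frobenius.

(** * Central and noncentral grades *)

Section CentralProduct.
Variables (F : fieldType) (p q : nat).
Hypothesis two : (2%:R : F) != 0.
Local Notation Cl := (cliff F p q).

Lemma basis_clT_central (X : Cl) : odd (p + q) ->
  basis_cl F [set: 'I_(p + q)]%SET * X = X * basis_cl F [set: 'I_(p + q)]%SET.
Proof.
move=> on; have := avg_com two (basis_cl F [set: 'I_(p + q)]%SET) X.
have -> : avg (basis_cl F [set: 'I_(p + q)]%SET) =
    (2 ^ (p + q))%:R *: basis_cl F [set: 'I_(p + q)]%SET :> Cl.
  by rewrite avg_basis; case: (central_ixP two) => // -[]; right.
by rewrite -scalerAl -scalerAr => /(scalerI (pow2_neq0 two _)).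
Qed.

(** The grades of [noncentral_sp] avoid 0 and, for odd n, also n = 2 * floor (n / 2) + 1, so X has
    no coordinate at a central basis element. *)
Lemma avg_noncentral (X : Cl) : X \in noncentral_sp F p q -> avg X = 0.
Proof.
move=> /mem_noncentral_sp X0; apply: avg_eq0 => A /(central_ixP two)[->|[on ->]].
  by apply: X0; rewrite cards0.
apply: X0; rewrite cardsT card_ord negb_and -ltnNge; apply/orP; right.
have := odd_double_half (p + q); rewrite on add1n -mul2n => {1}<-.
by rewrite ltnn.
Qed.

End CentralProduct.

(** * Smoothness and flatness of the connection *)

Section FlatConnection.
Variables (R : realType) (s : scalars) (p q r : nat).
Local Notation F := (scal R s).
Local Notation Cl := (cliff F p q).
Local Notation V := 'rV[R]_r.
Variables (h : 'I_(p + q) -> V -> Cl) (C : 'I_r -> V -> Cl).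
Hypothesis h_smooth : forall a, smooth_cl (h a).
Hypothesis h_rel : forall x, cliff_rel (h^~ x).
Hypothesis h_trace : odd (p + q) -> forall x, Tr_cl (full_prod (h^~ x)) = 0.
Hypothesis C_noncentral : forall mu x, C mu x \in noncentral_sp F p q.
Hypothesis C_system : forall a mu x,
  partial_cl mu (h a) x - comm_cl (C mu x) (h a x) = 0.

Let two : (2%:R : F) != 0 := scal_two_neq0 R s.

Lemma is_dcl_system a mu x :
  is_dcl (h a) x (evec R mu) (comm_cl (C mu x) (h a x)).
Proof.
apply: (is_dcl_eq (smooth_is_dcl mu x (h_smooth a))).
by apply/eqP; rewrite -subr_eq0 C_system.
Qed.

Lemma bprod_smooth A : smooth_cl (fun x => bprod (h^~ x) A).
Proof.
rewrite /bprod; elim: (index_enum _) => [|a l IHl].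
  by under eq_fun do rewrite big_nil; exact: smooth_cl_cst.
by under eq_fun do rewrite big_cons; case: (a \in A) => //; exact: smooth_clM.
Qed.

Lemma is_dcl_bprod A mu x : is_dcl (fun x => bprod (h^~ x) A) x (evec R mu)
  (comm_cl (C mu x) (bprod (h^~ x) A)).
Proof.
rewrite /bprod; elim: (index_enum _) => [|a l IHl].
  under eq_fun do rewrite big_nil; rewrite big_nil.
  apply: (is_dcl_eq (@is_dcl_cst R s p q V 1 x (evec R mu))).
  by rewrite /comm_cl mulr1 mul1r subrr.
under eq_fun do rewrite big_cons; rewrite big_cons; case: (a \in A) => //.
apply: (is_dcl_eq (is_dclM (is_dcl_system a mu x) IHl)).
rewrite /comm_cl mulrBl mulrBr !mulrA addrA subrK //.
Qed.

(** By the Leibniz rule each summand is C - h^A C (h^A)^-1, and the second parts add up to the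
    average of a noncentral element, which is zero. The right side involves h alone, so no
    regularity of C is presupposed. *)
Lemma connectionE mu x : C mu x = (2 ^ (p + q))%:R^-1 *:
  \sum_A sqsgn F A *: (partial_cl mu (fun x => bprod (h^~ x) A) x * bprod (h^~ x) A).
Proof.
have E A : sqsgn F A *: (partial_cl mu (fun x => bprod (h^~ x) A) x * bprod (h^~ x) A) =
    C mu x - sqsgn F A *: (bprod (h^~ x) A * C mu x * bprod (h^~ x) A).
  have [_ ->] := is_dcl_partial (is_dcl_bprod A mu x).
  rewrite /comm_cl mulrBl scalerBr -(mulrA (C mu x)) (bprod_sq two (h_rel x)).
  by rewrite -scalerAr mulr1 scalerA sqsgnK scale1r.
under eq_bigr do rewrite E.
rewrite big_split /= sumrN -/(intw _ _ _) (intw_self two _ (h_rel x)) //; last first.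
  by move=> on; exact: h_trace.
rewrite avg_noncentral // subr0 sumr_const -cardsT -powersetT card_powerset cardsT card_ord.
by rewrite -scaler_nat scalerA mulVf ?scale1r // pow2_neq0.
Qed.

Lemma connection_smooth mu : smooth_cl (C mu).
Proof.
have -> : C mu = (fun x => (2 ^ (p + q))%:R^-1 *: \sum_A sqsgn F A *:
    (partial_cl mu (fun x => bprod (h^~ x) A) x * bprod (h^~ x) A)).
  by apply/funext => x; exact: connectionE.
apply: smooth_clZ; apply: smooth_cl_sum => A; apply: smooth_clZ.
by apply: smooth_clM; [apply: smooth_cl_partial|]; exact: bprod_smooth.
Qed.

(** Coordinates outside the grades of N vanish identically in x, hence so do their derivatives. *)
Lemma partial_noncentral mu nu x : partial_cl mu (C nu) x \in noncentral_sp F p q.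
Proof.
apply/mem_noncentral_sp => A nA.
have C0 : (fun y => coord_cl (C nu y) A) = (fun=> 0).
  apply/funext => y; exact: (mem_noncentral_sp _).1 (C_noncentral nu y) A nA.
have rc0A b : rc (partial_cl mu (C nu) x) (A, b) = 0.
  rewrite rc_partial.
  have -> : (fun y => rc (C nu y) (A, b)) = cst 0.
    apply/funext => y; have := congr1 (fun g => g y) C0 => /= Cy0.
    by rewrite -(@rc0 R s p q (A, b)) /rc /= Cy0 /coord_cl ffunE.
  exact: derive_cst.
apply: scal_inj; first by have := rc0A false; rewrite /rc /= => ->; case: (s).
by have := rc0A true; rewrite /rc /= => ->; case: (s).
Qed.

Lemma connection_flat mu nu x :
  partial_cl mu (C nu) x - partial_cl nu (C mu) x = comm_cl (C mu x) (C nu x).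
Proof.
set D := partial_cl mu (C nu) x - partial_cl nu (C mu) x - comm_cl (C mu x) (C nu x).
suff D0 : D = 0 by apply/eqP; rewrite -subr_eq0 -/D D0.
have second a (k l : 'I_r) : partial_cl k (partial_cl l (h a)) x =
    partial_cl k (C l) x * h a x + C l x * comm_cl (C k x) (h a x) -
    (comm_cl (C k x) (h a x) * C l x + h a x * partial_cl k (C l) x).
  have -> : partial_cl l (h a) = (fun y => C l y * h a y - h a y * C l y).
    by apply/funext => y; have [_ ->] := is_dcl_partial (is_dcl_system a l y).
  apply: (is_dcl_partial _).2; apply: is_dclB; apply: is_dclM.
  - exact/smooth_is_dcl/connection_smooth.
  - exact: is_dcl_system.
  - exact: is_dcl_system.
  - exact/smooth_is_dcl/connection_smooth.
have DC a : h a x * D = D * h a x.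
  have := congr1 (fun f => f x) (smooth_cl_schwarz nu mu (h_smooth a)).
  rewrite /= !second /D /comm_cl.
  move: (partial_cl mu (C nu) x) (partial_cl nu (C mu) x) (C mu x) (C nu x) (h a x).
  move=> X Y A B H E; apply/eqP; rewrite -subr_eq0; apply/eqP.
  move/eqP: E; rewrite -subr_eq0 => /eqP; rewrite !(mulrBr, mulrBl) !mulrA.
  (* Once expanded, the claim is linear in these ten monomials and can be checked on real
     coordinates. *)
  move: (X * H) (H * X) (Y * H) (H * Y) (A * B * H) (B * A * H) (H * A * B) (H * B * A)
    (A * H * B) (B * H * A) => x1 x2 x3 x4 x5 x6 x7 x8 x9 x10 E.
  apply: rc_inj => j; have := congr1 (fun Z => rc Z j) E.
  by rewrite !(rcD, rcN) !rc0; lra.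
have DB A : bprod (h^~ x) A * D = D * bprod (h^~ x) A.
  apply: (big_ind (fun Z => Z * D = D * Z)) => [|U W UD WD|a _]; last exact: DC.
    by rewrite mulr1 mul1r.
  by rewrite -mulrA WD mulrA UD mulrA.
have : intw (h^~ x) (h^~ x) D = (2 ^ (p + q))%:R *: D.
  rewrite /intw; under eq_bigr do rewrite DB -mulrA (bprod_sq two (h_rel x)) -scalerAr mulr1
    scalerA sqsgnK scale1r.
  by rewrite sumr_const -cardsT -powersetT card_powerset cardsT card_ord scaler_nat.
rewrite (intw_self two _ (h_rel x)); last by move=> on; exact: h_trace.
have avgB (X Y : Cl) : avg (X - Y) = avg X - avg Y.
  by rewrite avgD; congr (_ + _); have := avgZ (-1) Y; rewrite !scaleN1r.
have -> : avg D = 0.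
  have c0 : avg (comm_cl (C mu x) (C nu x)) = 0.
    by rewrite /comm_cl avgB (avg_mulC (C nu x) (C mu x)) subrr.
  have n0 k l : avg (partial_cl k (C l) x) = 0.
    by apply: (avg_noncentral two); exact: partial_noncentral.
  by rewrite /D (avgB _ (comm_cl _ _)) c0 avgB !n0 !subrr.
move=> /esym/eqP; rewrite scaler_eq0 (negPf (pow2_neq0 two _)) /=.
by move=> /eqP.
Qed.

End FlatConnection.

Theorem theorem4 (R : realType) (s : scalars) (p q r : nat)
    (n_ge1 : (1 <= p + q)%N) (r_ge1 : (1 <= r)%N)
    (h : 'I_(p + q) -> 'rV[R]_r -> cliff (scal R s) p q)
    (h_smooth : forall a, smooth_cl (h a))
    (h_rel : forall a b x,
       h a x * h b x + h b x * h a x = (2 * eta (scal R s) p q a b) *: 1)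
    (h_trace : odd (p + q) ->
       forall x, Tr_cl (full_prod (fun a => h a x)) = 0)
    (C : 'I_r -> 'rV[R]_r -> cliff (scal R s) p q)
    (C_noncentral : forall mu x, C mu x \in noncentral_sp (scal R s) p q)
    (C_system : forall a mu x,
       partial_cl mu (h a) x - comm_cl (C mu x) (h a x) = 0) :
  exists S : 'rV[R]_r -> cliff (scal R s) p q,
    [/\ forall x, S x \is a GRing.unit,
        solves_system C S
      & exists K : cliff (scal R s) p q,
          let T := fun x => S x * K in
          [/\ K \is a GRing.unit,
              solves_system C T,
              forall x, T x \is a GRing.unit,
              ~~ odd (p + q) ->
                forall a x, gen_cl (scal R s) a = (T x)^-1 * h a x * T x
            & odd (p + q) ->
                let w := fun x => full_prod (fun a => h a x) *
                  (full_prod (fun a => gen_cl (scal R s) a))^-1 in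
                ((forall x, w x = 1) \/ (forall x, w x = -1)) /\
                forall a x,
                  gen_cl (scal R s) a = w x * (T x)^-1 * h a x * T x]].
Proof.
have two := scal_two_neq0 R s.
have hrel x : cliff_rel (h^~ x) by move=> a b; exact: h_rel.
have Csmooth := connection_smooth h_smooth hrel h_trace C_noncentral C_system.
have Cflat := connection_flat h_smooth hrel h_trace C_noncentral C_system.
have [S SP] := frobenius Csmooth Cflat (is_dcl_system h_smooth C_system) (leqnn r).
have Su x : S x \is a GRing.unit by have [] := SP x.
have dS mu x : is_dcl S x (evec R mu) (C mu x * S x) by have [_ dS _] := SP x; exact: dS.
(* With all r coordinates treated, the base point [zero_lt r x] is the origin. *)
have hS a x : h a x * S x = S x * h a 0.
  have [_ _ ->] := SP x; congr (_ * h a _); apply/rowP => i.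
  by rewrite !mxE ltn_ord.
have [b [K [b1 b_even Ku hK bT]]] := pauli_theorem two (hrel 0) (fun on => h_trace on 0).
have bb : b * b = 1 by case: b1 => ->; rewrite ?mulrNN mulr1.
have hT a x : h a x * (S x * K) = S x * K * (b *: gen_cl (scal R s) a).
  by rewrite mulrA hS -!mulrA hK.
have Tu x : S x * K \is a GRing.unit by rewrite unitrMr.
exists S; split=> //; first by move=> mu x; exact: is_dcl_partial.
exists K; split=> // [mu x|en a x|on].
- apply: is_dcl_partial.
  apply: (is_dcl_eq (is_dclM (dS mu x) (@is_dcl_cst R s p q _ K x (evec R mu)))).
  by rewrite mulr0 addr0 mulrA.
- by rewrite -mulrA hT mulKr // b_even // scale1r.
set w := fun x => _.
have genE : full_prod (@gen_cl (scal R s) p q) =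
    basis_cl (scal R s) [set: 'I_(p + q)]%SET by exact: full_prod_gen.
have wE x : w x = b *: 1.
  have eTu : full_prod (@gen_cl (scal R s) p q) \is a GRing.unit.
    rewrite genE; apply: (@left_inverse_unit _ _ _ _
      (sqsgn (scal R s) [set: 'I_(p + q)]%SET *: basis_cl (scal R s) [set: 'I_(p + q)]%SET)).
    by rewrite -scalerAl basis_cl_sq scalerA sqsgnK scale1r.
  (* The sign found at the origin holds everywhere: S(x) intertwines the products at x and at 0, and
     the latter is central. *)
  have hE : full_prod (h^~ x) = b *: full_prod (@gen_cl (scal R s) p q).
    apply: (mulIr (Su x)).
    have := bprod_intertwine [set: 'I_(p + q)]%SET (fun a => hS a x).
    rewrite -!full_prodE bT // => ->.
    by rewrite !genE -scalerAl -scalerAr basis_clT_central.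
  rewrite /w -[full_prod (fun a => h a x)]/(full_prod (h^~ x)) hE.
  by rewrite -scalerAl mulrV.
split.
  by case: b1 => bE; [left|right] => x; rewrite wE bE ?scaleN1r ?scale1r.
(* The sign b enters twice, through w and through [hT], and cancels. *)
move=> a x; rewrite wE -!scalerAl mul1r -mulrA hT mulKr //.
by rewrite scalerA bb scale1r.
Qed.
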